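(* Let $m$ be a positive integer and let $\rho=(\rho_1,\ldots,\rho_m)\in(0,1]^m$. Then every subset $S\subseteq \mathbb{A}_{\rho}^m$ that is closed under complex conjugation and contains the zero vector $(0,\ldots,0)$ is the exceptional set $S_f$ of uncountably many transcendental functions $f\in \mathbb{Z}_{\rho}[[z_1,\ldots,z_m]]$.
   Context: $\overline{\mathbb{Q}}$ denotes the field of algebraic numbers. For $w\in\mathbb{C}^m$ and $\rho\in\mathbb{R}_{>0}^m$, the open polydisc is $\Delta(w;\rho)=\{z\in\mathbb{C}^m : |z_i-w_i|<\rho_i \text{ for all } 1\le i\le m\}$. $\mathbb{A}_\rho^m=\overline{\mathbb{Q}}^m\cap\Delta(0;\rho)$ is the set of $m$-tuples of algebraic numbers lying in $\Delta(0;\rho)$. A set $S\subseteq\mathbb{C}^m$ is closed under complex conjugation if $(\overline{z_1},\ldots,\overline{z_m})\in S$ whenever $(z_1,\ldots,z_m)\in S$. $\mathbb{Z}_\rho[[z_1,\ldots,z_m]]$ denotes the set of power series $\sum_{(k_1,\ldots,k_m)\in\mathbb{N}_0^m} f_{(k_1,\ldots,k_m)} z_1^{k_1}\cdots z_m^{k_m}$ with integer coefficients and polyradius of convergence $\rho$ (so in particular they define analytic functions on $\Delta(0;\rho)$). An analytic function $f:\Omega\subseteq\mathbb{C}^m\to\mathbb{C}$ is transcendental if the only polynomial $P\in\mathbb{C}[X_1,\ldots,X_{m+1}]$ with $P(z_1,\ldots,z_m,f(z_1,\ldots,z_m))=0$ for all $(z_1,\ldots,z_m)\in\Omega$ is the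 zero polynomial. The exceptional set of an analytic $f:\Omega\to\mathbb{C}$ is $S_f=\{\alpha\in\overline{\mathbb{Q}}^m\cap\Omega : f(\alpha)\in\overline{\mathbb{Q}}\}$; here $\Omega=\Delta(0;\rho)$. *)

(* Defs.v *)
From HB Require Import structures.
From mathcomp Require Import all_boot all_order all_algebra finmap.
From mathcomp Require Import all_classical all_reals all_analysis.
From mathcomp Require Import complex.
(* Importing the notations of [mpoly] would clash with those of the analysis
   library, hence the filter and the qualified names below. *)
From mathcomp Require Import (canonicals, coercions) mpoly.
From mathcomp.analysis.showcase Require summability.

Set Implicit Arguments.
Unset Strict Implicit.
Unset Printing Implicit Defensive.

Import Order.TTheory GRing.Theory Num.Theory.
Import numFieldNormedType.Exports.

Local Open Scope classical_set_scope.
Local Open Scope ring_scope.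
Local Open Scope complex_scope.

Section Defs.
Context {R : realType} {m : nat}.
Implicit Types (z w : 'rV[R[i]]_m) (rho : 'rV[R]_m).

Definition polydisc w rho : set 'rV[R[i]]_m :=
  [set z | forall i, `|z 0 i - w 0 i| < (rho 0 i)%:C].

Definition algebraic_number (x : R[i]) : Prop := algebraicOver ratr x.

Definition algebraic_points (Omega : set 'rV[R[i]]_m) : set 'rV[R[i]]_m :=
  [set z | Omega z /\ forall i, algebraic_number (z 0 i)].

Definition conj_closed (S : set 'rV[R[i]]_m) : Prop :=
  forall z, S z -> S (map_mx (@conjc R) z).

(* A power series with integer coefficients in m variables is its family of
   coefficients, indexed by the multi-indices k in N^m. *)
Definition int_powser : Type := {ffun 'I_m -> nat} -> int.

Definition powser_term (f : int_powser) z (k : {ffun 'I_m -> nat}) : R[i] :=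
  (f k)%:~R * \prod_(i < m) z 0 i ^+ k i.

(* Convergence of a multiple power series is absolute convergence, so that no
   order on the multi-indices has to be chosen. *)
Definition powser_cvg (f : int_powser) z : Prop :=
  esum.summable [set: {ffun 'I_m -> nat}]
    (fun k => (ComplexField.Normc.normc (powser_term f z k))%:E).

(* The limit of the partial sums over the finite sets of multi-indices, ordered
   by inclusion; only meaningful where [powser_cvg f z] holds. *)
Definition powser_fun (f : int_powser) z : R[i] :=
  @summability.sum _ R[i] R[i]^o (powser_term f z).

(* [rho] is the polyradius of a maximal open polydisc centred at 0 on which the
   series converges: none of the radii can be enlarged. In several variables
   such a [rho] is in general not unique. *)
Definition has_polyradius (f : int_powser) rho : Prop :=
  polydisc 0 rho `<=` powser_cvg f /\
  forall rho', (forall i, rho 0 i <= rho' 0 i) ->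
    polydisc 0 rho' `<=` powser_cvg f -> rho' = rho.

(* The last variable of P is the one that F z is substituted for. *)
Definition transcendental (Omega : set 'rV[R[i]]_m) (F : 'rV[R[i]]_m -> R[i]) :
    Prop :=
  forall P : mpoly.mpoly (m + 1) R[i],
    (forall z, Omega z ->
       mpoly.meval (fun j => row_mx z (F z)%:M 0 j) P = 0) ->
    P = 0.

Definition exceptional_set (Omega : set 'rV[R[i]]_m) (F : 'rV[R[i]]_m -> R[i]) :
    set 'rV[R[i]]_m :=
  [set z | algebraic_points Omega z /\ algebraic_number (F z)].

End Defs.

Arguments int_powser m : clear implicits.

(* Main.v *)
Require Import Defs.
From HB Require Import structures.
From mathcomp Require Import all_boot all_order all_algebra finmap.
From mathcomp Require Import all_classical all_reals all_analysis.
From mathcomp Require Import complex.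
From mathcomp Require Import ring lra zify.
From mathcomp Require Import (canonicals, coercions) mpoly.
From mathcomp.analysis.showcase Require summability.

(* The required series is F = lim F_n, where F_0 has coefficients close to
   2 W_k with W_k = prod_i (k_i + 1) rho_i^-k_i, and F_(n+1) - F_n is an integer
   series with coefficients at most 2^-(n+1) W_k; then W_k <= F_k <= 4 W_k, so
   rho is a polyradius of F. Let a_0, a_1, ... enumerate the algebraic points of
   the polydisc. The n-th correction vanishes at a_j for j < n, and changes the
   value at a_n (if a_n is nonzero and is not an a_j or its conjugate, j < n) to
   any sufficiently close number, real if a_n is real. Hence F (a_n) can be
   chosen algebraic or transcendental, as prescribed by S, and still outside any
   given finite set.

   The corrections are z_i^t (q + p h): q is a real polynomial interpolating at
   the a_j, p is a real polynomial with constant term 1 vanishing at them, the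
   coefficients of h are chosen in (0, 1] one degree after the other so as to
   make those of q + p h integral, and t is large enough for the bound.

   Given a sequence of series, F differs from its first n members at a_n, so the
   set of all solutions is not countable. For transcendence, for each d <= n the
   value F (a_n) is chosen to be no zero of P (a_n, -) for some polynomial P of
   size at most d that vanishes at all (a_j, F (a_j)), j < n, if there is such a
   P with P (a_n, -) <> 0. A nonzero P with P (z, F z) = 0 would provide such
   polynomials for infinitely many n, hence infinitely many linearly independent
   polynomials of bounded degree. *)

Set Implicit Arguments.
Unset Strict Implicit.
Unset Printing Implicit Defensive.

Import Order.TTheory GRing.Theory Num.Theory.
Import numFieldNormedType.Exports.

Local Open Scope classical_set_scope.
Local Open Scope ring_scope.

Local Notation normc := ComplexField.Normc.normc.
Local Notation normc0 := ComplexField.Normc.normc0.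
Local Notation normcM := ComplexField.Normc.normcM.
Local Notation cj := (map_mx (@conjc _)).
Local Notation pt z y := (fun j => row_mx z y%:M 0 j).

(** * The real-valued modulus of complex numbers *)

Section Normc.
Context {R : realType}.
Implicit Types x y : R[i].

Lemma normcE x : `|x| = ((normc x)%:C)%C.
Proof. by []. Qed.

Lemma lt_normc x (r : R) : (`|x| < (r%:C)%C) = (normc x < r).
Proof. by rewrite normcE ltcR. Qed.

Lemma normc_ge0 x : 0 <= normc x.
Proof. by rewrite -ler0c -normcE. Qed.

Lemma normc_eq0 x : (normc x == 0) = (x == 0).
Proof.
apply/eqP/eqP => [/ComplexField.Normc.eq0_normc//|->].
exact: normc0.
Qed.

Lemma normc_gt0 x : (0 < normc x) = (x != 0).
Proof. by rewrite lt_neqAle normc_ge0 andbT eq_sym normc_eq0. Qed.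

Lemma normcX x n : normc (x ^+ n) = normc x ^+ n.
Proof.
elim: n => [|n IHn]; first by rewrite !expr0 ComplexField.Normc.normc1.
by rewrite !exprS normcM IHn.
Qed.

Lemma normc_prod (I : finType) (F : I -> R[i]) :
  normc (\prod_i F i) = \prod_i normc (F i).
Proof.
exact: (big_morph _ (@normcM R) (@ComplexField.Normc.normc1 R)).
Qed.

Lemma normc_conj x : normc x^*%C = normc x.
Proof. by case: x => a b /=; rewrite sqrrN. Qed.

Lemma normc_real (a : R) : normc (a%:C)%C = `|a|.
Proof. by rewrite /= expr0n addr0 sqrtr_sqr. Qed.

Lemma normc_int (n : int) : normc (n%:~R : R[i]) = `|n%:~R : R|.
Proof. by rewrite -normc_real rmorph_int. Qed.

Lemma conjc_int (n : int) : ((n%:~R : R[i])^*)%C = n%:~R.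
Proof. exact: (rmorph_int (@conjc R)). Qed.

Lemma normcD x y : normc (x + y) <= normc x + normc y.
Proof. by rewrite -lecR rmorphD /= -!normcE ler_normD. Qed.

Lemma normcN x : normc (- x) = normc x.
Proof. by case: x => a b /=; rewrite !sqrrN. Qed.

Lemma normc_distC x y : normc (x - y) = normc (y - x).
Proof. by rewrite -normcN opprB. Qed.

Lemma normc_sum (T : Type) (r : seq T) (F : T -> R[i]) :
  normc (\sum_(i <- r) F i) <= \sum_(i <- r) normc (F i).
Proof.
elim: r => [|i r IHr]; first by rewrite !big_nil normc0.
by rewrite !big_cons (le_trans (normcD _ _)) // lerD2l.
Qed.

Lemma normc_small x : (forall e : R, 0 < e -> normc x < e) -> x = 0.
Proof.
move=> xe; apply/eqP; rewrite -normc_eq0 eq_le normc_ge0 andbT leNgt.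
by apply/negP => /xe; rewrite ltxx.
Qed.

End Normc.

(** * Unordered summation of complex families *)

Section HasSum.
Context {R : realType} {I : choiceType}.
Implicit Types (x y : I -> R[i]) (A B : {fset I}).

(** Convergence along the finite subsets of [I], directed by inclusion. Stating it with [normc]
    keeps all estimates in the ordered field [R]. *)
Definition has_sum x (s : R[i]) := forall e : R, 0 < e ->
  exists A, forall B, (A `<=` B)%fset -> normc (\sum_(i <- B) x i - s) < e.

Lemma has_sum_sum x s : has_sum x s -> @summability.sum _ R[i] R[i]^o x = s.
Proof.
move=> xs; apply: cvg_lim => //=.
  exact: summability.totally_filter.
have ? : Filter (@summability.totally I) by apply: summability.totally_filter.
apply/cvgrPdist_lt => e e0 /=.
have [r er] : exists r : R, e = (r%:C)%C by apply/complex_realP; apply: gtr0_real.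
rewrite er in e0 *; have r0 : 0 < r by rewrite -ltcR.
have [A AP] := xs _ r0; exists A => // B /= AB.
rewrite normcE ltcR -normcN opprB /summability.partial_sum.
by rewrite -[X in normc (X - _)](big_seq_fsetE _ _ predT); apply: AP.
Qed.

Lemma eq_has_sum x y s : x =1 y -> has_sum x s -> has_sum y s.
Proof. by move=> /funext ->. Qed.

Lemma has_sumD x y s t : has_sum x s -> has_sum y t ->
  has_sum (fun i => x i + y i) (s + t).
Proof.
move=> xs yt e e0; have e20 : 0 < e / 2 by lra.
have [A AP] := xs _ e20; have [B BP] := yt _ e20.
exists (A `|` B)%fset => D; rewrite fsubUset => /andP[/AP + /BP].
rewrite big_split /= => h1 h2.
rewrite (_ : _ - _ = (\sum_(i <- D) x i - s) + (\sum_(i <- D) y i - t));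
  last by ring.
by apply: le_lt_trans (normcD _ _) _; lra.
Qed.

Lemma has_sumZ a x s : has_sum x s -> has_sum (fun i => a * x i) (a * s).
Proof.
move=> xs e e0; have a0 := normc_ge0 a.
have : 0 < e / (normc a + 1) by rewrite divr_gt0 //; lra.
move=> /xs[A AP]; exists A => B /AP.
rewrite -mulr_sumr -mulrBr normcM ltr_pdivlMr; last by lra.
move=> h; apply: le_lt_trans h; rewrite mulrC ler_wpM2l ?normc_ge0 //; lra.
Qed.

Lemma has_sum_conj x s :
  has_sum x s -> has_sum (fun i => (x i)^*%C) (s^*%C).
Proof.
move=> xs e /xs[A AP]; exists A => B /AP.
by rewrite -rmorph_sum -rmorphB normc_conj.
Qed.

Lemma has_sum_norm_le x s (M : R) : has_sum x s ->
  (forall A, \sum_(i <- A) normc (x i) <= M) -> normc s <= M.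
Proof.
move=> xs xM; rewrite leNgt; apply/negP => Ms.
have : 0 < normc s - M by lra.
move=> /xs[A /(_ A (fsubset_refl A))].
have := xM A; have := normc_sum A x.
have := normcD (\sum_(i <- A) x i) (s - \sum_(i <- A) x i).
rewrite addrC subrK normc_distC; lra.
Qed.

(** The hypotheses make [g] injective and let [x] vanish off its range, so only the terms along [g]
    count. It serves to shift exponents in multiplication by a variable. *)
Lemma has_sum_reindex (f g : I -> I) x y s : cancel g f ->
  (forall k, x (g k) = y k) -> (forall k, g (f k) != k -> x k = 0) ->
  has_sum y s -> has_sum x s.
Proof.
move=> gK xg x0 ys e /ys[A AP]; exists (g @` A)%fset => B AB.
pose B' := [fset k in (f @` B)%fset | g k \in B]%fset.
have gB : (g @` B' `<=` B)%fset.
  by apply/fsubsetP => k /imfsetP[k' /=]; rewrite !inE => /andP[_ ?] ->.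
rewrite -(big_fset_incl _ gB) => [|k kB kB']; last first.
  apply: x0; apply: contra kB' => /eqP gfk.
  apply/imfsetP; exists (f k) => //=.
  by rewrite !inE gfk kB andbT; apply/imfsetP; exists k.
rewrite big_imfset /= => [|? ? _ _ /(can_inj gK)//].
under eq_bigr do rewrite xg.
apply: AP; apply/fsubsetP => k kA; rewrite !inE /=.
have gkB : g k \in B by apply: (fsubsetP AB); apply/imfsetP; exists k.
by rewrite gkB andbT; apply/imfsetP; exists (g k) => //=; rewrite gK.
Qed.

Lemma ler_sum_fsubset (y : I -> R) A B : (forall i, 0 <= y i) -> (A `<=` B)%fset ->
  \sum_(i <- A) y i <= \sum_(i <- B) y i.
Proof.
move=> y0 AB; rewrite (@big_fsetID _ _ _ _ (mem A) B) /=.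
rewrite (_ : [fset _ in _ | _]%fset = A) ?lerDl ?sumr_ge0 //.
apply/fsetP => i; rewrite !inE /=.
by case: (boolP (i \in A)) => [/(fsubsetP AB)->|]; rewrite ?andbF.
Qed.

Lemma has_sum_ge0 (y : I -> R) (M : R) : (forall i, 0 <= y i) ->
  (forall A, \sum_(i <- A) y i <= M) ->
  exists s, has_sum (fun i => (y i)%:C%C) (s%:C%C).
Proof.
move=> y0 yM; pose E := range (fun A : {fset I} => \sum_(i <- A) y i).
have supE : has_sup E.
  split; first by exists (\sum_(i <- fset0%fset) y i), fset0%fset.
  by exists M => _ [A _ <-].
exists (sup E) => e e0.
have [_ [A _ <-] eA] := sup_adherent e0 supE.
exists A => B AB; rewrite -rmorph_sum -rmorphB normc_real.
have := ler_sum_fsubset y0 AB.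
have : \sum_(i <- B) y i <= sup E by apply: ub_le_sup; [case: supE|exists B].
by rewrite ltr_norml; lra.
Qed.

Lemma has_sum_real (y : I -> R) (M : R) :
  (forall A, \sum_(i <- A) `|y i| <= M) ->
  exists s, has_sum (fun i => (y i)%:C%C) (s%:C%C).
Proof.
move=> yM.
have part (z : I -> R) : (forall i, 0 <= z i <= `|y i|) ->
    exists s, has_sum (fun i => (z i)%:C%C) (s%:C%C).
  move=> zy; apply: (@has_sum_ge0 _ M) => [i|A]; first by case/andP: (zy i).
  by apply: le_trans (yM A); apply: ler_sum => i _; case/andP: (zy i).
have [i|s sP] := part (fun i => Num.max (y i) 0).
  by rewrite le_max lexx orbT /= ge_max ler_norm normr_ge0.
have [i|t tP] := part (fun i => Num.max (- y i) 0).
  by rewrite le_max lexx orbT /= ge_max -normrN ler_norm normr_ge0.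
exists (s - t); have := has_sumD sP (has_sumZ (-1) tP).
rewrite mulN1r -rmorphB; apply: eq_has_sum => i.
rewrite mulN1r -rmorphB; congr (_%:C)%C.
by case: (leP (y i) 0); case: (leP (- y i) 0); lra.
Qed.

Lemma has_sum_exists x (M : R) :
  (forall A, \sum_(i <- A) normc (x i) <= M) -> exists s, has_sum x s.
Proof.
move=> xM.
have part (z : I -> R) : (forall i, `|z i| <= normc (x i)) ->
    exists s, has_sum (fun i => (z i)%:C%C) (s%:C%C).
  move=> zx; apply: (@has_sum_real _ M) => A.
  by apply: le_trans (xM A); apply: ler_sum.
have sqr_le (a b : R) : `|a| <= Num.sqrt (a ^+ 2 + b ^+ 2).
  by rewrite -sqrtr_sqr ler_wsqrtr // lerDl sqr_ge0.
have [i|s sP] := part (fun i => complex.Re (x i)).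
  by case: (x i) => a b; apply: sqr_le.
have [i|t tP] := part (fun i => complex.Im (x i)).
  by case: (x i) => a b; rewrite /= addrC; apply: sqr_le.
exists (s%:C + 'i * t%:C)%C; have := has_sumD sP (has_sumZ 'i%C tP).
by apply: eq_has_sum => i; rewrite -complexE.
Qed.

End HasSum.

(** * Monomials, weights and evaluation of power series *)

Section Evaluation.
Context {R : realType} {m : nat}.
Local Notation C := R[i].
Local Notation I := {ffun 'I_m -> nat}.
Implicit Types (z : 'rV[C]_m) (rho : 'rV[R]_m) (k : I) (c d : I -> C).

Definition monomial z k : C := \prod_(i < m) z 0 i ^+ k i.

(** The powers of [rho] fix the polydisc of convergence. The linear factors do not change it, but
    make the weight unbounded in each exponent even where [rho 0 i] is 1, so that bounded
    coefficients of high order are small compared with it. *)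
Definition weight rho k : R := \prod_(i < m) ((k i).+1%:R * (rho 0 i)^-1 ^+ k i).

(** Complex coefficients are allowed because the corrections are assembled from pieces that are not
    integral. *)
Definition ev c z : C := @summability.sum _ C C^o (fun k => c k * monomial z k).

Lemma powser_funE (f : int_powser m) z : powser_fun f z = ev (fun k => (f k)%:~R) z.
Proof. by []. Qed.

Definition dominated rho c (B : R) := forall k, normc (c k) <= B * weight rho k.

Definition incr_exp (i : 'I_m) k : I := [ffun j => (k j + (j == i))%N].
Definition decr_exp (i : 'I_m) k : I := [ffun j => (k j - (j == i))%N].
Definition mulX i c k : C := if (0 < k i)%N then c (decr_exp i k) else 0.

Lemma incr_expK i : cancel (incr_exp i) (decr_exp i).
Proof. by move=> k; apply/ffunP => j; rewrite !ffunE addnK. Qed.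

Lemma decr_expK i k : (0 < k i)%N -> incr_exp i (decr_exp i k) = k.
Proof.
by move=> ki; apply/ffunP => j; rewrite !ffunE; case: eqP => [->|_] /=; lia.
Qed.

Lemma monomial_incr z i k : monomial z (incr_exp i k) = z 0 i * monomial z k.
Proof.
rewrite /monomial; under eq_bigr do rewrite ffunE exprD.
rewrite big_split mulrC /=; congr (_ * _).
rewrite (bigD1 i) //= eqxx expr1 big1 ?mulr1 // => j ji.
by rewrite (negbTE ji) expr0.
Qed.

Lemma sum_arith_geom (x : R) N : 0 <= x < 1 ->
  \sum_(j < N) (j.+1%:R * x ^+ j) <= (1 - x) ^- 2.
Proof.
move=> /andP[x0 x1]; have x1' : 0 < 1 - x by lra.
(* The finite form of the derivative of the geometric series; the right-hand side is at most 1
   because [x ^+ N.+1 <= x ^+ N]. *)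
have E : (1 - x) ^+ 2 * \sum_(j < N) (j.+1%:R * x ^+ j) =
    1 - N.+1%:R * x ^+ N + N%:R * x ^+ N.+1.
  elim: N => [|N IHN]; first by rewrite big_ord0 expr0; ring.
  by rewrite big_ord_recr /= mulrDr IHN !exprS -!natr1; ring.
rewrite -[X in _ <= X]mul1r ler_pdivlMr ?exprn_gt0 // mulrC E.
have xN : 0 <= x ^+ N by rewrite exprn_ge0.
rewrite exprS -natr1; have N0 : 0 <= N%:R :> R by [].
have : N%:R * (x * x ^+ N) <= N%:R * x ^+ N.
  by rewrite ler_wpM2l // ler_piMl // ltW.
lra.
Qed.

Lemma weight_monomial rho z k : weight rho k * normc (monomial z k) =
  \prod_(i < m) ((k i).+1%:R * (normc (z 0 i) / rho 0 i) ^+ k i).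
Proof.
rewrite normc_prod -big_split /=; apply: eq_bigr => i _.
by rewrite normcX exprMn; ring.
Qed.

Lemma polydiscE rho z : (polydisc 0 rho) z <-> forall i, normc (z 0 i) < rho 0 i.
Proof.
by split=> zr i; have := zr i; rewrite mxE subr0 -lt_normc.
Qed.

Lemma polydisc_conj rho z : (polydisc 0 rho) z ->
  (polydisc 0 rho) (map_mx (@conjc R) z).
Proof.
by move=> /polydiscE zr; apply/polydiscE => i; rewrite mxE normc_conj.
Qed.

(* Comparison with the product of the series [\sum_j (j + 1) x_i^j], where
   [x_i = |z_i| / rho_i < 1]. *)
Lemma weight_summable rho z : (polydisc 0 rho) z ->
  exists2 M, 0 <= M &
    forall A : {fset I}, \sum_(k <- A) weight rho k * normc (monomial z k) <= M.
Proof.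
move=> /polydiscE zr.
pose x i := normc (z 0 i) / rho 0 i.
have r0 i : 0 < rho 0 i by apply: le_lt_trans (zr i); apply: normc_ge0.
have x01 i : 0 <= x i < 1.
  by rewrite divr_ge0 ?normc_ge0 ?ltW //= ltr_pdivrMr // mul1r.
have x0 i : 0 <= x i by case/andP: (x01 i).
exists (\prod_i (1 - x i) ^- 2) => [|A].
  apply: prodr_ge0 => i _; rewrite invr_ge0 exprn_ge0 // subr_ge0 ltW //.
  by case/andP: (x01 i).
pose t k : R := \prod_(i < m) ((k i).+1%:R * x i ^+ k i).
have t0 k : 0 <= t k by apply: prodr_ge0 => i _; rewrite mulr_ge0 ?exprn_ge0.
rewrite (eq_bigr t) => [|k _]; last exact: weight_monomial.
pose N := (\max_(k <- A) \max_i k i)%N.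
have kN k i : k \in A -> (k i < N.+1)%N.
  move=> kA; rewrite ltnS; apply: leq_trans (leq_bigmax_seq _ kA isT).
  exact: leq_bigmax.
pose f k : {ffun 'I_m -> 'I_N.+1} := [ffun i => inord (k i)].
pose g (s : {ffun 'I_m -> 'I_N.+1}) : I := [ffun i => nat_of_ord (s i)].
have gf k : k \in A -> g (f k) = k.
  by move=> kA; apply/ffunP => i; rewrite !ffunE inordK // kN.
have -> : \sum_(k <- A) t k = \sum_(s <- map f A) t (g s).
  by rewrite big_map big_seq [RHS]big_seq; apply: eq_bigr => k /gf ->.
rewrite big_uniq /=; last first.
  rewrite map_inj_in_uniq ?fset_uniq // => k l kA lA fkl.
  by rewrite -(gf k) // fkl gf.
apply: (@le_trans _ _ (\sum_s t (g s))).
  rewrite [X in _ <= X](bigID (mem (map f A))) /= lerDl sumr_ge0 //.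
have -> : \sum_s t (g s) = \prod_i \sum_(j < N.+1) (j.+1%:R * x i ^+ j).
  rewrite bigA_distr_bigA /=; apply: eq_bigr => s _; apply: eq_bigr => i _.
  by rewrite ffunE.
apply: ler_prod => i _; rewrite sum_arith_geom // andbT.
by apply: sumr_ge0 => j _; rewrite mulr_ge0 ?exprn_ge0.
Qed.

End Evaluation.

(** * Series dominated by the weight, and operations on them *)

Section Dominated.
Context {R : realType} {m : nat} (rho : 'rV[R]_m).
Hypothesis rho_itv : forall i, 0 < rho 0 i <= 1.
Local Notation C := R[i].
Local Notation I := {ffun 'I_m -> nat}.
Implicit Types (z : 'rV[C]_m) (k : I) (c d : I -> C).

Let inv_rho_ge1 i n : 1 <= (rho 0 i)^-1 ^+ n.
Proof. by case/andP: (rho_itv i) => r0 r1; rewrite exprn_ege1 // invf_ge1. Qed.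

Lemma ge_weight i k : (k i).+1%:R <= weight rho k.
Proof.
rewrite /weight (bigD1 i) //=; set a := (X in _ <= X * _); set b := (X in _ <= _ * X).
have a1 : (k i).+1%:R <= a by rewrite ler_peMr.
apply: le_trans a1 _; rewrite ler_peMr ?mulr_ge0 ?exprn_ge0 //.
  by rewrite invr_ge0; case/andP: (rho_itv i) => /ltW.
rewrite /b; elim/big_ind : _ => // [x y x1 y1|j _]; first by rewrite mulr_ege1.
by rewrite mulr_ege1 // ler1n.
Qed.

Lemma weight_ge1 k : 1 <= weight rho k.
Proof.
rewrite /weight; elim/big_ind : _ => // [x y x1 y1|j _].
  by rewrite mulr_ege1.
by rewrite mulr_ege1 // ler1n.
Qed.

Lemma weight_ge0 k : 0 <= weight rho k.
Proof. exact: le_trans (weight_ge1 k). Qed.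

(** Since [rho 0 i <= 1], the inverse radii are at least 1 and the weight grows with every exponent.
    Multiplication by a variable therefore preserves domination. *)
Lemma weight_decr i k : weight rho (decr_exp i k) <= weight rho k.
Proof.
apply: ler_prod => j _; case/andP: (rho_itv j) => r0 r1; rewrite ffunE.
have ki : (k j - (j == i) <= k j)%N by rewrite leq_subr.
have v0 : 0 <= (rho 0 j)^-1 by rewrite invr_ge0 ltW.
rewrite mulr_ge0 ?exprn_ge0 //=; apply: ler_pM; rewrite ?exprn_ge0 ?ler_nat //.
by rewrite ler_weXn2l // invf_ge1.
Qed.

Definition tame c := exists B, dominated rho c B.

Lemma bounded_dominated c B : (forall k, normc (c k) <= B) -> dominated rho c B.
Proof.
move=> cB k; apply: le_trans (cB k) _.
have B0 : 0 <= B by apply: le_trans (cB k); apply: normc_ge0.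
by rewrite ler_peMr // weight_ge1.
Qed.

Lemma bounded_tame c B : (forall k, normc (c k) <= B) -> tame c.
Proof. by move=> /bounded_dominated; exists B. Qed.

Lemma tameD c d : tame c -> tame d -> tame (fun k => c k + d k).
Proof.
move=> [B cB] [B' dB']; exists (B + B') => k.
by rewrite mulrDl (le_trans (normcD _ _)) // lerD.
Qed.

Lemma tameZ a c : tame c -> tame (fun k => a * c k).
Proof.
move=> [B cB]; exists (normc a * B) => k.
by rewrite normcM -mulrA ler_wpM2l ?normc_ge0.
Qed.

Lemma tame_mulX i c : tame c -> tame (mulX i c).
Proof.
move=> [B cB]; exists B => k.
have B0 : 0 <= B.
  rewrite -(pmulr_lge0 _ (lt_le_trans ltr01 (weight_ge1 k))).
  by apply: le_trans (cB k); apply: normc_ge0.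
rewrite /mulX; case: ifP => _.
  by apply: le_trans (cB _) _; rewrite ler_wpM2l // weight_decr.
by rewrite normc0 mulr_ge0 // weight_ge0.
Qed.

Lemma tame_conj c : tame c -> tame (fun k => (c k)^*%C).
Proof. by move=> [B cB]; exists B => k; rewrite normc_conj. Qed.

Lemma dominated_ge0 c B : dominated rho c B -> 0 <= B.
Proof.
move=> /(_ [ffun=> 0%N]) cB.
rewrite -(pmulr_lge0 _ (lt_le_trans ltr01 (weight_ge1 [ffun=> 0%N]))).
by apply: le_trans cB; apply: normc_ge0.
Qed.

(** The constant [M] depends on the point alone. This uniformity in [c] makes values converge when
    coefficients converge relative to the weight. *)
Lemma dominated_sum z : (polydisc 0 rho) z ->
  exists M, forall c B, dominated rho c B -> forall A : {fset I},
    \sum_(k <- A) normc (c k * monomial z k) <= B * M.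
Proof.
move=> /weight_summable[M M0 zM]; exists M => c B cB A.
apply: le_trans (ler_wpM2l (dominated_ge0 cB) (zM A)).
rewrite mulr_sumr; apply: ler_sum => k _.
by rewrite normcM mulrA ler_wpM2r ?normc_ge0.
Qed.

Section Point.
Variable z : 'rV[C]_m.
Hypothesis z_in : (polydisc 0 rho) z.

Lemma ev_has_sum c : tame c -> has_sum (fun k => c k * monomial z k) (ev c z).
Proof.
move=> [B cB]; have [M zM] := dominated_sum z_in.
have [s xs] := has_sum_exists (zM c B cB).
by rewrite /ev (has_sum_sum xs).
Qed.

Lemma ev_eq c s : has_sum (fun k => c k * monomial z k) s -> ev c z = s.
Proof. exact: has_sum_sum. Qed.

Lemma ev_norm_le : exists M, forall c B, dominated rho c B -> normc (ev c z) <= B * M.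
Proof.
have [M zM] := dominated_sum z_in; exists M => c B cB.
by apply: has_sum_norm_le (zM c B cB); apply: ev_has_sum; exists B.
Qed.

Lemma evD c d : tame c -> tame d -> ev (fun k => c k + d k) z = ev c z + ev d z.
Proof.
move=> /ev_has_sum cs /ev_has_sum ds; apply: ev_eq.
by apply: eq_has_sum (has_sumD cs ds) => k; rewrite mulrDl.
Qed.

Lemma evZ a c : tame c -> ev (fun k => a * c k) z = a * ev c z.
Proof.
move=> /ev_has_sum cs; apply: ev_eq.
by apply: eq_has_sum (has_sumZ a cs) => k; rewrite mulrA.
Qed.

Lemma ev_mulX i c : tame c -> ev (mulX i c) z = z 0 i * ev c z.
Proof.
move=> /ev_has_sum cs; apply: ev_eq.
apply: (has_sum_reindex (@incr_expK m i)) (has_sumZ (z 0 i) cs) => [k|k].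
  rewrite /mulX ffunE eqxx addn1 /= incr_expK monomial_incr; ring.
rewrite /mulX; case: (posnP (k i)) => [_|/decr_expK ->]; first by rewrite mul0r.
by rewrite eqxx.
Qed.

End Point.

Lemma ev_conj c z : (polydisc 0 rho) z -> tame c ->
  ev (fun k => (c k)^*%C) (map_mx (@conjc R) z) = ((ev c z)^*)%C.
Proof.
move=> zin /(ev_has_sum zin) cs; apply: ev_eq.
apply: eq_has_sum (has_sum_conj cs) => k; rewrite rmorphM; congr (_ * _).
rewrite rmorph_prod; apply: eq_bigr => i _; rewrite rmorphXn mxE //.
Qed.

Definition constant_series (a : C) : I -> C :=
  fun k => if k == [ffun=> 0%N] then a else 0.

Lemma constant_series_le a k : normc (constant_series a k) <= normc a.
Proof.
rewrite /constant_series; case: ifP => // _.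
by rewrite normc0 normc_ge0.
Qed.

Lemma ev_constant a z : ev (constant_series a) z = a.
Proof.
apply: ev_eq => e e0; exists [fset [ffun=> 0%N]]%fset => B; rewrite fsub1set => B0.
rewrite (big_fsetD1 _ B0) /= /constant_series eqxx /monomial.
rewrite big1 => [|i _]; last by rewrite ffunE.
rewrite big1_fset => [|k]; last first.
  by rewrite !inE => /andP[/negbTE -> _] _; rewrite mul0r.
by rewrite mulr1 addr0 subrr normc0.
Qed.

End Dominated.

(** * Separation of points and real interpolation *)

Section Step.
Context {R : realType} {m : nat} (rho : 'rV[R]_m).
Hypothesis rho_itv : forall i, 0 < rho 0 i <= 1.
Local Notation C := R[i].
Local Notation I := {ffun 'I_m -> nat}.
Implicit Types (z : 'rV[C]_m) (k : I) (c d h q : I -> C) (pts : seq 'rV[C]_m).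

Definition real_valued c := forall k, (c k)^*%C = c k.
Definition bounded_by (B : R) c := forall k, normc (c k) <= B.
Definition integral c := forall k, exists n : int, c k = n%:~R.

Lemma bounded_by_tame B c : bounded_by B c -> tame rho c.
Proof. exact: bounded_tame. Qed.

Lemma bounded_by_ge0 B c : bounded_by B c -> 0 <= B.
Proof. by move=> /(_ [ffun=> 0%N]); apply: le_trans; apply: normc_ge0. Qed.

Lemma bounded_mulX B i c : bounded_by B c -> bounded_by B (mulX i c).
Proof.
move=> cB k; rewrite /mulX; case: ifP => // _.
by rewrite normc0 (bounded_by_ge0 cB).
Qed.

Lemma bounded_lin B B' a c d : bounded_by B c -> bounded_by B' d ->
  bounded_by (B + normc a * B') (fun k => c k + a * d k).
Proof.
move=> cB dB k; apply: le_trans (normcD _ _) _; rewrite normcM.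
by rewrite lerD // ler_wpM2l // normc_ge0.
Qed.

(** The series is a product of linear factors [z_i - p_i], one for each [p], in a coordinate [i]
    where [p] differs from [alpha]. *)
Lemma separate pts (alpha : 'rV[C]_m) : (polydisc 0 rho) alpha ->
  {in pts, forall p, (polydisc 0 rho) p /\ p <> alpha} ->
  exists c B, [/\ bounded_by B c, {in pts, forall p, ev c p = 0} & ev c alpha != 0].
Proof.
move=> aD; elim: pts => [|p pts IH] ptsP.
  exists (constant_series 1), 1; split => //.
    by move=> k; apply: le_trans (constant_series_le _ _) _; rewrite ComplexField.Normc.normc1.
  by rewrite ev_constant oner_neq0.
have [|c [B [cB c0 ca]]] := IH.
  by move=> x xp; apply: ptsP; rewrite inE xp orbT.
have [pD pa] := ptsP p (mem_head _ _).
have [i pi] : exists i, p 0 i <> alpha 0 i.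
  by apply: contrapT => /forallNP H; apply: pa; apply/rowP => i; apply: contrapT; apply: H.
have tc := bounded_by_tame cB.
have evE x : (polydisc 0 rho) x ->
    ev (fun k => mulX i c k + (- p 0 i) * c k) x = (x 0 i - p 0 i) * ev c x.
  move=> xD; rewrite (evD rho_itv xD) ?(evZ rho_itv xD) ?(ev_mulX rho_itv xD) //.
  - by ring.
  - exact: tame_mulX.
  - exact: tameZ.
exists (fun k => mulX i c k + (- p 0 i) * c k), (B + normc (- p 0 i) * B); split.
- exact: bounded_lin (bounded_mulX i cB) cB.
- move=> x; rewrite inE => /predU1P[->|xp]; first by rewrite evE // subrr mul0r.
  have [|xD _] := ptsP x; first by rewrite inE xp orbT.
  by rewrite evE // c0 // mulr0.
- by rewrite evE // mulf_neq0 // subr_eq0; apply/eqP => H; apply: pi.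
Qed.

Lemma cjK z : cj (cj z) = z.
Proof. by apply/rowP => i; rewrite !mxE conjcK. Qed.

(** Adding to a multiple of a separating polynomial its coefficientwise conjugate makes the
    coefficients real. The bound is linear in [w], with [K] chosen before [w]. *)
Lemma interpolate pts (alpha : 'rV[C]_m) : (polydisc 0 rho) alpha ->
  {in pts, forall p, [/\ (polydisc 0 rho) p, p <> alpha & cj p <> alpha]} ->
  exists K, forall w, (cj alpha = alpha -> w^*%C = w) ->
  exists q, [/\ real_valued q, bounded_by (K * normc w) q,
    {in pts, forall p, ev q p = 0} & ev q alpha = w].
Proof.
move=> aD ptsP.
(* Conjugates are killed as well, because the conjugate series takes at [p] the conjugate of the
   value at [cj p]. *)
pose pts' := pts ++ map cj pts ++ (if cj alpha == alpha then [::] else [:: cj alpha]).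
have [|c [B [cB c0 ca]]] := @separate pts' alpha aD.
  move=> p; rewrite !mem_cat => /or3P[/ptsP[]//|/mapP[x /ptsP[xD _ xa] ->]|].
    by split => //; apply: polydisc_conj.
  case: eqP => // aa; rewrite inE => /eqP ->; split=> //; exact: polydisc_conj.
(* If [alpha] is real, both summands contribute equally at [alpha], hence the factor 2; otherwise
   the second one vanishes there. *)
pose e := if cj alpha == alpha then (2 : C) else 1.
have e0 : e != 0 by rewrite /e; case: ifP => _; rewrite ?oner_neq0 ?pnatr_eq0.
exists (2 * normc (e * ev c alpha)^-1 * B) => w wreal.
pose a := w / (e * ev c alpha).
have tac : tame rho (fun k => a * c k) by apply: tameZ; apply: bounded_by_tame cB.
have qE p : (polydisc 0 rho) p -> ev (fun k => a * c k + (a * c k)^*%C) p =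
    a * ev c p + (a * ev c (cj p))^*%C.
  move=> pD; rewrite (evD rho_itv pD) //; last exact: tame_conj.
  rewrite -[in X in _ + X = _](cjK p) (ev_conj rho_itv) //; last exact: polydisc_conj.
  rewrite !(evZ rho_itv) //; try exact: polydisc_conj; exact: bounded_by_tame cB.
exists (fun k => a * c k + (a * c k)^*%C); split.
- by move=> k; rewrite rmorphD /= conjcK addrC.
- move=> k; apply: le_trans (normcD _ _) _; rewrite normc_conj.
  have : normc (a * c k) <= normc (e * ev c alpha)^-1 * B * normc w.
    rewrite /a; set v := (_ * _)^-1.
    have -> : normc (w * v * c k) = normc v * normc (c k) * normc w.
      by rewrite !normcM; ring.
    by rewrite ler_wpM2r ?normc_ge0 // ler_wpM2l ?normc_ge0.
  lra.
- move=> p pp; have [pD _ _] := ptsP p pp; rewrite qE // !c0.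
  + by rewrite !mulr0 conjc0 addr0.
  + by rewrite !mem_cat (map_f _ pp) orbT.
  + by rewrite mem_cat pp.
- rewrite qE // /a /e; case: (eqVneq (cj alpha) alpha) => [aa|aa].
    rewrite aa (_ : w / _ * _ = w / 2); last by rewrite invfM mulrA divfK.
    have -> : ((w / 2)^*)%C = w / 2.
      by rewrite fmorph_div rmorph_nat; congr (_ / _); apply: wreal.
    by field.
  rewrite (c0 (cj alpha)); last by rewrite !mem_cat (negbTE aa) mem_seq1 eqxx !orbT.
  by rewrite mulr0 conjc0 addr0 mul1r divfK.
Qed.

(** * Annihilating multipliers and rounding to integral coefficients *)

Definition degree k := (\sum_i k i)%N.

Lemma degree_decr i k : (0 < k i)%N -> (degree (decr_exp i k) < degree k)%N.
Proof.
move=> ki; rewrite /degree (bigD1 i) //= [X in (_ < X)%N](bigD1 i) //= ffunE eqxx.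
rewrite -addSn subn1 prednK // leq_add2l; apply: leq_sum => j _.
by rewrite ffunE leq_subr.
Qed.

(* The model is multiplication by a series with constant term 1. *)
Definition unitriangular (U : (I -> C) -> I -> C) := forall h h' n,
  (forall k, (degree k < n)%N -> h k = h' k) ->
  forall k, (degree k <= n)%N -> U h k - h k = U h' k - h' k.

Lemma mulX_local i h h' n : (forall k, (degree k < n)%N -> h k = h' k) ->
  forall k, (degree k <= n)%N -> mulX i h k = mulX i h' k.
Proof.
move=> hh' k kn; rewrite /mulX; case: ifP => // /degree_decr kd.
by apply: hh'; apply: leq_trans kn.
Qed.

Definition mul_quadratic (i : 'I_m) (b d : C) h k : C :=
  h k + b * mulX i h k + d * mulX i (mulX i h) k.

(** These are the coefficients of [(1 - x / a) (1 - x / conj a)], which has constant term 1. *)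
Lemma real_quadratic (a : C) : a != 0 ->
  exists b d : C, [/\ b^*%C = b, d^*%C = d & 1 + b * a + d * a ^+ 2 = 0].
Proof.
move=> a0; exists (- (a^-1 + (a^-1)^*%C)), (a^-1 * (a^-1)^*%C); split.
- by rewrite rmorphN rmorphD /= conjcK addrC.
- by rewrite rmorphM /= conjcK mulrC.
- by move: (conjc _) => e; field.
Qed.

(** [U] multiplies by one real quadratic per point, in a coordinate where that point is nonzero. The
    constant terms 1 make [U] unitriangular. *)
Lemma annihilate pts : {in pts, forall p, (polydisc 0 rho) p /\ p != 0} ->
  exists U K, [/\ forall h, real_valued h -> real_valued (U h),
    forall h B, bounded_by B h -> bounded_by (K * B) (U h),
    unitriangular U &
    forall h B, bounded_by B h -> {in pts, forall p, ev (U h) p = 0}].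
Proof.
elim: pts => [|p pts IH] ptsP.
  exists id, 1; split => // [h B hB|h h' n _ k _].
    by rewrite mul1r.
  by rewrite !subrr.
have [|U [K [Ureal Ubd Utri U0]]] := IH.
  by move=> x xp; apply: ptsP; rewrite inE xp orbT.
have [pD p0] := ptsP p (mem_head _ _).
have [i pi] : exists i, p 0 i != 0.
  apply: contrapT => /forallNP H; case/negP: p0; apply/eqP/rowP => i.
  by rewrite mxE; apply/eqP; apply: contrapT => /negP; apply: H.
have [b [d [breal dreal bd0]]] := real_quadratic pi.
exists (fun h => mul_quadratic i b d (U h)), (K + normc b * K + normc d * K); split.
- have mulX_real h : real_valued h -> real_valued (mulX i h).
    by move=> hr k; rewrite /mulX; case: ifP => _; rewrite ?conjc0 ?hr.
  move=> h /Ureal hr k; rewrite /mul_quadratic !(rmorphD, rmorphM) /= breal dreal.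
  by rewrite hr (mulX_real _ hr) (mulX_real _ (mulX_real _ hr)).
- move=> h B /Ubd UB; rewrite mulrDl mulrDl -!mulrA.
  apply: bounded_lin; last by apply/bounded_mulX/bounded_mulX.
  by apply: bounded_lin => //; apply: bounded_mulX.
- move=> h h' n hh' k kn.
  (* [U h] and [U h'] agree below degree [n], and a shift by a variable carries this to degree
     [n]. *)
  have UU j : (degree j < n)%N -> U h j = U h' j.
    by move=> jn; have := Utri _ _ _ hh' j (ltnW jn); rewrite hh' // => /addIr.
  have sU j := mulX_local i UU (k := j).
  have ssU := mulX_local i (n := n) (fun j jn => sU j (ltnW jn)) kn.
  rewrite /mul_quadratic ssU (sU _ kn).
  by have := Utri _ _ _ hh' k kn => /eqP; rewrite subr_eq => /eqP ->; ring.
- move=> h B hB x; rewrite inE => xp.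
  have [xD _] : (polydisc 0 rho) x /\ x != 0 by apply: ptsP; rewrite inE.
  have tU := bounded_by_tame (Ubd h B hB).
  have t1 := tame_mulX rho_itv i tU; have t2 := tame_mulX rho_itv i t1.
  have -> : ev (mul_quadratic i b d (U h)) x =
      (1 + b * x 0 i + d * x 0 i ^+ 2) * ev (U h) x.
    rewrite (evD rho_itv xD (c := fun k => U h k + b * mulX i (U h) k)
      (d := fun k => d * mulX i (mulX i (U h)) k)); last exact: tameZ.
      rewrite (evD rho_itv xD) ?(evZ rho_itv xD) ?(ev_mulX rho_itv xD) //.
        by ring.
      exact: tameZ.
    by apply: tameD => //; apply: tameZ.
  case/predU1P: xp => [->|/(U0 _ _ hB) ->]; last by rewrite mulr0.
  by rewrite bd0 mul0r.
Qed.

(** Solves for the coefficients degree by degree. While those of degree [n'] are still 0, [x] is the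
    coefficient obtained so far; adding the number in (0, 1] that lifts it to [floor x + 1] makes it
    integral. In the real case used below, [Re] only changes the type. *)
Fixpoint rounding (q : I -> C) (U : (I -> C) -> I -> C) n : I -> C :=
  if n is n'.+1 then fun k =>
    if degree k == n' then
      let x := complex.Re (q k + U (rounding q U n') k) in
      (((Num.floor x)%:~R + 1 - x)%:C)%C
    else rounding q U n' k
  else fun=> 0.

Lemma rounding_integral q U : real_valued q ->
  (forall h, real_valued h -> real_valued (U h)) -> unitriangular U ->
  exists h, [/\ real_valued h, bounded_by 1 h & integral (fun k => q k + U h k)].
Proof.
move=> qreal Ureal Utri.
have r_real n : real_valued (rounding q U n).
  elim: n => [|n IHn] k /=; first by apply: conjc0.
  by case: ifP => _; [rewrite conjc_real | rewrite IHn].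
have r0 n k : (n <= degree k)%N -> rounding q U n k = 0.
  elim: n => [//|n IHn] nk /=; rewrite gtn_eqF // IHn // ltnW //.
have rS n p k : (degree k < n)%N -> rounding q U (n + p)%N k = rounding q U n k.
  move=> kn; elim: p => [|p IHp]; first by rewrite addn0.
  by rewrite addnS /= ltn_eqF // (leq_trans kn) // leq_addr.
pose h k := rounding q U (degree k).+1 k.
have hr n k : (degree k < n)%N -> h k = rounding q U n k.
  by move=> kn; rewrite /h -(subnKC kn) rS.
have hE k : h k = (((Num.floor (complex.Re (q k + U (rounding q U (degree k)) k)))%:~R + 1
    - complex.Re (q k + U (rounding q U (degree k)) k))%:C)%C.
  by rewrite /h /= eqxx.
exists h; split => [k|k|k].
- exact: r_real.
- rewrite hE normc_real; set x := complex.Re _.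
  have := floor_le_tmp x; have := floorD1_gt x.
  rewrite intrD ler_norml; lra.
(* Compare [h] with its truncation below [degree k], which vanishes at [k]: [U h k] exceeds [h k] by
   a quantity already known when [h k] was chosen. *)
- have UhE : U h k = h k + U (rounding q U (degree k)) k.
    have := Utri h (rounding q U (degree k)) (degree k) (hr _) k (leqnn _).
    by rewrite r0 // subr0 => <-; ring.
  set y := q k + U (rounding q U (degree k)) k.
  have yE : y = ((complex.Re y)%:C)%C.
    have : y^*%C = y by rewrite /y rmorphD /= qreal Ureal.
    by case: (y) => a b [] /= ?; congr (_ +i* _)%C; lra.
  exists (Num.floor (complex.Re y) + 1)%R.
  rewrite UhE addrCA -/y hE -/y [in X in _ + X]yE -(raddfD (real_complex R)).
  by rewrite -(rmorph_int (real_complex R)) intrD; congr (_%:C)%C; ring.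
Qed.

(** * Multiplication by powers of a variable, and the correction step *)

Lemma integral_mulX i c t : integral c -> integral (iter t (mulX i) c).
Proof.
move=> cint; elim: t => [//|t IHt] k /=; rewrite /mulX.
by case: ifP => _; [apply: IHt | exists 0].
Qed.

Lemma iter_mulX_small i c t k : (k i < t)%N -> iter t (mulX i) c k = 0.
Proof.
elim: t k => [//|t IHt] k kt /=; rewrite /mulX; case: ifP => // k0.
by apply: IHt; rewrite ffunE eqxx; lia.
Qed.

Lemma bounded_iter_mulX B i c t : bounded_by B c -> bounded_by B (iter t (mulX i) c).
Proof. by move=> cB; elim: t => [//|t IHt] /=; apply: bounded_mulX. Qed.

Lemma ev_iter_mulX B i c t z : (polydisc 0 rho) z -> bounded_by B c ->
  ev (iter t (mulX i) c) z = z 0 i ^+ t * ev c z.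
Proof.
move=> zD cB; elim: t => [|t IHt]; first by rewrite mul1r.
rewrite /= (ev_mulX rho_itv zD) ?IHt ?exprS ?mulrA //.
exact: bounded_by_tame (bounded_iter_mulX i t cB).
Qed.

(** [delta] is found before [w], so that [w] can be picked afterwards by arithmetic conditions.
    Realness of [w] is required only for real [alpha], where a series with real coefficients takes
    real values. *)
Lemma step pts (alpha : 'rV[C]_m) (eta : R) : 0 < eta ->
  (polydisc 0 rho) alpha -> alpha != 0 ->
  {in pts, forall p, [/\ (polydisc 0 rho) p, p != 0, p <> alpha & cj p <> alpha]} ->
  exists2 delta : R, 0 < delta & forall w : C, normc w <= delta ->
    (cj alpha = alpha -> w^*%C = w) ->
    exists g : int_powser m, [/\ dominated rho (fun k => (g k)%:~R) eta,
      {in pts, forall p, powser_fun g p = 0} & powser_fun g alpha = w].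
Proof.
move=> eta0 aD a0 ptsP.
have [|K Kinterp] := @interpolate pts alpha aD.
  by move=> p /ptsP[].
(* [alpha] is among the points killed, so the rounding term does not disturb the value that [q]
   takes there. *)
have [|U [K' [Ureal Ubd Utri U0]]] := @annihilate (alpha :: pts).
  by move=> p; rewrite inE => /predU1P[->|/ptsP[]].
have [i ai] : exists i, alpha 0 i != 0.
  apply: contrapT => /forallNP H; case/negP: a0; apply/eqP/rowP => i.
  by rewrite mxE; apply/eqP; apply: contrapT => /negP; apply: H.
(* Chosen so that the bound on the coefficients is at most [eta] times [t + 1], which the weight
   dominates as soon as [k i] exceeds [t]. *)
pose t := Num.truncn ((`|K| + `|K'|) / eta).
have tK : `|K| + `|K'| <= eta * t.+1%:R.
  by rewrite mulrC -ler_pdivrMr // ltW // truncnS_gt.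
(* The factor [alpha_i ^ (t + 1)] is divided out of [w]; this radius keeps the quotient [v] in the
   closed unit disc, so the bound on [q] does not depend on [w]. *)
exists (normc (alpha 0 i) ^+ t.+1) => [|w wd wreal].
  by rewrite exprn_gt0 // normc_gt0.
pose v := w / alpha 0 i ^+ t.+1.
have v1 : normc v <= 1.
  rewrite /v normcM ComplexField.Normc.normcV normcX ler_pdivrMr ?mul1r //.
  by rewrite exprn_gt0 // normc_gt0.
have [|q [qreal qB q0 qa]] := Kinterp v.
  move=> aa; rewrite /v fmorph_div rmorphXn; congr (_ / _ ^+ _); first exact: wreal.
  by rewrite -[in RHS]aa mxE.
have [h [hreal hB hint]] := rounding_integral qreal Ureal Utri.
pose c k := q k + U h k.
have tq := bounded_by_tame qB; have tU := bounded_by_tame (Ubd _ _ hB).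
have cB : bounded_by (`|K| + `|K'|) c.
  move=> k; apply: le_trans (normcD _ _) _; apply: lerD.
    apply: le_trans (qB k) _; apply: le_trans (ler_norm _) _.
    by rewrite normrM (ger0_norm (normc_ge0 _)) ler_piMr.
  by apply: le_trans (Ubd _ _ hB k) _; rewrite mulr1 ler_norm.
have [g gP] := choice (integral_mulX i t.+1 hint).
have gE : (fun k => (g k)%:~R) = iter t.+1 (mulX i) c by apply/funext => k; rewrite gP.
have evg p : (polydisc 0 rho) p ->
    powser_fun g p = p 0 i ^+ t.+1 * (ev q p + ev (U h) p).
  by move=> pD; rewrite powser_funE gE (ev_iter_mulX _ _ pD cB) (evD rho_itv pD tq tU).
exists g; split.
- move=> k; rewrite -gP; have [kt|kt] := ltnP (k i) t.+1.
    by rewrite iter_mulX_small // normc0 mulr_ge0 ?(weight_ge0 rho_itv) // ltW.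
  apply: le_trans (bounded_iter_mulX i t.+1 cB k) (le_trans tK _).
  rewrite (ler_wpM2l (ltW eta0)) //; apply: le_trans (ge_weight rho_itv i k).
  by rewrite ler_nat (leq_trans kt).
- move=> p pp; have [pD _ _ _] := ptsP p pp.
  by rewrite evg // q0 // (U0 h 1) // ?addr0 ?mulr0 // inE pp orbT.
- rewrite evg // qa (U0 h 1) // ?mem_head // addr0 /v mulrC divfK //.
  by rewrite expf_neq0.
Qed.

End Step.

(** * Algebraic and transcendental numbers near a given number *)

Section Algebraic.
Context {R : realType}.
Local Notation C := R[i].
Implicit Types x : C.

Lemma polynomial_zeros (F : closedFieldType) (p : {poly F}) : p != 0 ->
  exists r : seq F, forall x : F, root p x -> x \in r.
Proof.
move=> p0; have [r pr] := closed_field_poly_normal p; exists r => x.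
by rewrite pr rootZ ?lead_coef_eq0 // root_prod_XsubC.
Qed.

Lemma algebraic_numbers_countable : countable [set x : C | algebraic_number x].
Proof.
pose F (p : {poly rat}) := [set x : C | p != 0 /\ root (map_poly ratr p) x].
apply: (@sub_countable _ _ _ (\bigcup_(p in setT) F p)).
  apply: subset_card_le => x [p p0 px]; exists p => //.
apply: bigcup_countable => [|p _]; first exact: countableP.
apply: finite_set_countable.
have [p0|p0] := eqVneq p 0.
  by rewrite (_ : F p = set0) // -subset0 => x [] /=; rewrite p0 eqxx.
have [|r rP] := @polynomial_zeros _ (map_poly (ratr : rat -> C) p).
  by rewrite map_poly_eq0.
by apply: sub_finite_set (finite_seq r) => x [_ /rP].
Qed.

Lemma countable_rV m (A : set C) : countable A ->
  countable [set z : 'rV[C]_m | forall i, A (z 0 i)].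
Proof.
move=> /countable_injP[f f_inj]; apply/countable_injP.
pose code (z : 'rV[C]_m) : {ffun 'I_m -> nat} := [ffun i => f (z 0 i)].
exists (fun z => choice.pickle (code z)) => z z' zA z'A fz.
have := pcan_inj choice.pickleK fz => /ffunP fzz'; apply/rowP => i.
have := fzz' i; rewrite !ffunE; apply: f_inj; rewrite inE.
  by move: zA; rewrite inE.
by move: z'A; rewrite inE.
Qed.

Lemma algebraic_conj x : algebraic_number x -> algebraic_number x^*%C.
Proof.
move=> [p p0 px]; exists p => //.
have -> : map_poly (ratr : rat -> C) p = map_poly conjc (map_poly (ratr : rat -> C) p).
  rewrite -map_poly_comp; apply: eq_map_poly => q /=.
  exact/esym/(fmorph_eq_rat (@conjc R \o (ratr : rat -> C)) q).
by rewrite fmorph_root.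
Qed.

Lemma algebraic_conjE x : algebraic_number x^*%C <-> algebraic_number x.
Proof.
by split=> [/algebraic_conj|/algebraic_conj//]; rewrite conjcK.
Qed.

Lemma algebraic_rat (q : rat) : algebraic_number (ratr q : C).
Proof. exact: algebraic_id. Qed.

Lemma algebraic_int (n : int) : algebraic_number (n%:~R : C).
Proof. by rewrite -(ratr_int C n); apply: algebraic_rat. Qed.

Lemma algebraic_i : algebraic_number ('i%C : C).
Proof.
exists ('X^2 + 1).
  by rewrite -size_poly_eq0 size_polyDl ?size_polyXn ?size_poly1.
rewrite rmorphD /= map_polyXn rmorph1 /root hornerD hornerXn hornerC.
by rewrite sqr_i addNr.
Qed.

Lemma ratrC (q : rat) : ratr q = ((ratr q : R)%:C)%C :> C.
Proof. exact/esym/(fmorph_eq_rat (real_complex R \o (ratr : rat -> R)) q). Qed.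

(** Induction on [L]: the interval is shrunk so as to miss the real part of [x], and then no
    rational number in it equals [x]. *)
Lemma rat_in_itv_avoiding (a b : R) (L : seq C) : a < b ->
  exists q : rat, a < ratr q < b /\ (ratr q : C) \notin L.
Proof.
elim: L a b => [|x L IH] a b ab.
  by have [q] := rat_in_itvoo ab; rewrite in_itv /=; exists q.
pose c := complex.Re x.
have [a' [b' [ab' aa' bb' cab']]] : exists a' b',
    [/\ a' < b', a <= a', b' <= b & ~ (a' < c < b')].
  have [ca|ca] := leP c a; first by exists a, b; split => // /andP[]; lra.
  have [cb|cb] := leP b c; first by exists a, b; split => // /andP[]; lra.
  by exists a, c; split; [lra|lra|lra|case/andP; lra].
have [q [/andP[aq qb] qL]] := IH _ _ ab'.
exists q; split; first by apply/andP; split; lra.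
rewrite inE negb_or qL andbT; apply/eqP => qx; apply: cab'.
by rewrite /c -qx ratrC /= aq.
Qed.

(** The sum [x + w] is taken in the Gaussian rationals, with imaginary part 0 if [x] is real. Its
    real part is chosen last, to avoid [L]. *)
Lemma algebraic_near x (delta : R) (L : seq C) : 0 < delta ->
  exists w, [/\ normc w <= delta, x^*%C = x -> w^*%C = w,
    algebraic_number (x + w) & x + w \notin L].
Proof.
move=> d0; case: x => a b.
have [q' [q'0 q'b]] : exists q' : rat,
    (b = 0 -> ratr q' = 0 :> R) /\ `|ratr q' - b| <= delta / 2.
  have [->|b0] := eqVneq b 0.
    by exists 0; rewrite rmorph0 subr0 normr0; split => //; lra.
  have [|q'] := @rat_in_itvoo R (b - delta / 2) (b + delta / 2); first lra.
  rewrite in_itv /= => q'b; exists q'; split=> [/eqP|]; first by rewrite (negbTE b0).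
  by rewrite ler_norml; lra.
have [|q [qa qL]] := @rat_in_itv_avoiding (a - delta / 2) (a + delta / 2)
  [seq y - 'i%C * ratr q' | y <- L]; first lra.
have xw : (a +i* b + ((ratr q - a) +i* (ratr q' - b)))%C = ratr q + 'i%C * ratr q' :> C.
  by rewrite !ratrC; apply/eqP; rewrite eq_complex /=; apply/andP; split; apply/eqP; ring.
exists ((ratr q - a) +i* (ratr q' - b))%C; split; rewrite ?xw.
- rewrite [X in normc X]complexE; apply: le_trans (normcD _ _) _.
  have ni : normc 'i%C = 1 :> R by rewrite /= expr0n expr1n add0r sqrtr1.
  rewrite normcM !normc_real ni mul1r /=.
  have : `|ratr q - a| <= delta / 2 by rewrite ler_norml; lra.
  lra.
- by move=> [] /= bb; congr (_ +i* _)%C; rewrite q'0; lra.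
- apply: algebraic_add; first exact: algebraic_rat.
  by apply: algebraic_mul; [apply: algebraic_i | apply: algebraic_rat].
- apply: contra qL => qL; apply/mapP; exists (ratr q + 'i%C * ratr q') => //.
  by rewrite addrK.
Qed.

(** The real shifts between 0 and [delta] are uncountably many, as that interval has positive
    Lebesgue measure, whereas the algebraic numbers and [L] together are countable. *)
Lemma transcendental_near x (delta : R) (L : seq C) : 0 < delta ->
  exists w, [/\ normc w <= delta, w^*%C = w,
    ~ algebraic_number (x + w) & x + w \notin L].
Proof.
move=> d0; apply: contrapT => H.
pose A := [set y : C | algebraic_number y] `|` [set` L].
have cA : countable A.
  rewrite /A -bigcup2E; apply: bigcup_countable => [|[|[|n]] _] /=.
  - exact: countableP.
  - exact: algebraic_numbers_countable.
  - exact: finite_set_countable (finite_seq L).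
  - exact: countable0.
have cI : countable (`[0, delta]%classic : set R).
  apply/countable_injP; have /countable_injP[f f_inj] := cA.
  have IA s : s \in (`[0, delta]%classic : set R) -> x + (s%:C)%C \in A.
    rewrite inE /= in_itv /= => /andP[s0 sd]; rewrite inE; apply: contrapT => nA.
    apply: H; exists (s%:C)%C; split.
    - by rewrite normc_real ger0_norm.
    - exact: conjc_real.
    - by move=> ?; apply: nA; left.
    - by apply/negP => ?; apply: nA; right.
  exists (fun s => f (x + (s%:C)%C)) => s t /IA sA /IA tA /(f_inj _ _ sA tA).
  by move=> /addrI /complexI.
have := countable_lebesgue_measure0 cI.
rewrite lebesgue_measure_itv /= lte_fin d0 sube0 => /eqP.
by rewrite eqe gt_eqF.
Qed.

End Algebraic.

(** * Nonvanishing and linear independence of multivariate polynomials *)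

Section Mpoly.
Context {F : fieldType}.

Lemma exists_uniq_seq (Q : set F) k : (forall L : seq F, exists2 x, Q x & x \notin L) ->
  exists s : seq F, [/\ size s = k, uniq s & forall x, x \in s -> Q x].
Proof.
move=> Qinf; elim: k => [|k [s [sk us sQ]]]; first by exists [::].
have [x Qx xs] := Qinf s; exists (x :: s); split; rewrite /= ?sk ?xs //.
by move=> y; rewrite inE => /predU1P[->//|/sQ].
Qed.

(** The nodes being distinct, the Vandermonde system can be solved for the combination that picks
    out the power [j0]. *)
Lemma coefficient_extraction d (x : 'I_d -> F) (j0 : nat) : injective x ->
  exists c : 'I_d -> F, forall j, (j < d)%N ->
    \sum_(s < d) c s * x s ^+ j = (j == j0)%:R.
Proof.
move=> x_inj; pose V : 'M[F]_d := Vandermonde d (\row_i x i).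
have uV : V \in unitmx.
  rewrite unitmxE det_Vandermonde unitfE; apply/prodf_neq0 => i _.
  apply/prodf_neq0 => j ij; rewrite !mxE subr_eq0; apply/eqP => /x_inj ji.
  by rewrite ji ltnn in ij.
pose v : 'cV[F]_d := \col_j ((j : nat) == j0)%:R.
exists (fun s => (invmx V *m v) s 0) => j jd.
have := congr1 (fun A : 'cV[F]_d => A (Ordinal jd) 0) (mulKVmx uV v).
rewrite [LHS]mxE [RHS]mxE /= => <-; apply: eq_bigr => s _.
by rewrite [V _ _]mxE [(\row_i x i) _ _]mxE mulrC.
Qed.

(* Extract a nonzero coefficient of [P] as a linear combination of the values
   of [P] on a product of finite subsets of the [Q i]. *)
Lemma mpoly_nonvanishing n (P : mpoly.mpoly n F) (Q : 'I_n -> set F) : P != 0 ->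
  (forall i (L : seq F), exists2 x, Q i x & x \notin L) ->
  exists2 v : 'I_n -> F, (forall i, Q i (v i)) & mpoly.meval v P != 0.
Proof.
move=> P0 Qinf; pose d := mpoly.mmeasure mpoly.mdeg P.
have md (mm : mpoly.multinom n) i : mm \in mpoly.msupp P ->
    (mpoly.fun_of_multinom mm i < d)%N.
  move=> /mpoly.msize_mdeg_lt; apply: leq_ltn_trans.
  by rewrite mpoly.mdegE (bigD1 i) //= leq_addr.
have [m0 m0P] : exists m0, m0 \in mpoly.msupp P.
  case E : (mpoly.msupp P) => [|m0 s]; last by exists m0; rewrite mem_head.
  by move: P0; rewrite -mpoly.msupp_eq0 E.
have /choice[s sP] : forall i, exists s : seq F,
    [/\ size s = d, uniq s & forall x, x \in s -> Q i x].
  by move=> i; apply: exists_uniq_seq; apply: Qinf.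
pose x i (j : 'I_d) := nth 0 (s i) j.
have xQ i j : Q i (x i j).
  by have [sz _ +] := sP i; apply; rewrite mem_nth ?sz.
have /choice[c cP] : forall i, exists c : 'I_d -> F, forall j, (j < d)%N ->
    \sum_(t < d) c t * x i t ^+ j = (j == mpoly.fun_of_multinom m0 i)%:R.
  move=> i; apply: coefficient_extraction => j j'; have [sz us _] := sP i.
  by move=> /eqP; rewrite nth_uniq ?sz // => /eqP /val_inj.
apply: contrapT => H.
have vanish (f : {ffun 'I_n -> 'I_d}) : mpoly.meval (fun i => x i (f i)) P = 0.
  apply/eqP; apply: contrapT => /negP Pf; apply: H.
  by exists (fun i => x i (f i)).
have : \sum_(f : {ffun 'I_n -> 'I_d})
    (\prod_i c i (f i)) * mpoly.meval (fun i => x i (f i)) P = mpoly.mcoeff m0 P.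
  under eq_bigr do rewrite mpoly.mevalE mulr_sumr.
  rewrite exchange_big /=.
  have sE (mm : mpoly.multinom n) : mm \in mpoly.msupp P ->
      \sum_(f : {ffun 'I_n -> 'I_d}) (\prod_i c i (f i)) *
        (mpoly.mcoeff mm P * \prod_i x i (f i) ^+ mpoly.fun_of_multinom mm i) =
      if mm == m0 then mpoly.mcoeff m0 P else 0.
    move=> mmP.
    transitivity (mpoly.mcoeff mm P * \sum_(f : {ffun 'I_n -> 'I_d})
        \prod_i (c i (f i) * x i (f i) ^+ mpoly.fun_of_multinom mm i)).
      by rewrite mulr_sumr; apply: eq_bigr => f _; rewrite big_split /= mulrCA.
    rewrite -(bigA_distr_bigA (fun i j => c i j * x i j ^+ mpoly.fun_of_multinom mm i)) /=.
    rewrite (eq_bigr (fun i => (mpoly.fun_of_multinom mm i ==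
        mpoly.fun_of_multinom m0 i)%:R)) => [|i _]; last by rewrite cP // md.
    case: eqP => [->|mm0]; first by rewrite big1 ?mulr1 // => i _; rewrite eqxx.
    have [i mi] : exists i, mpoly.fun_of_multinom mm i <> mpoly.fun_of_multinom m0 i.
      by apply: contrapT => /forallNP e; apply: mm0; apply/mpoly.mnmP => i; apply: contrapT.
    by rewrite (bigD1 i) //= (introF eqP mi) mul0r mulr0.
  rewrite big_seq (eq_bigr _ sE) -big_seq.
  rewrite (bigD1_seq m0) //= ?mpoly.msupp_uniq // eqxx big1 ?addr0 // => i.
  by move=> /negbTE ->.
rewrite big1 => [/esym/eqP|f _]; last by rewrite vanish mulr0.
by rewrite mpoly.mcoeff_eq0 m0P.
Qed.

(** Substituting [z] for the first variables leaves a univariate polynomial, nonzero because of its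
    value at [y0]. *)
Lemma mpoly_last_zeros (K : closedFieldType) m (P : mpoly.mpoly (m + 1) K)
    (z : 'rV[K]_m) y0 :
  mpoly.meval (fun j => row_mx z y0%:M 0 j) P != 0 ->
  exists L : seq K, forall y, mpoly.meval (fun j => row_mx z y%:M 0 j) P = 0 -> y \in L.
Proof.
pose v (j : 'I_(m + 1)) : {poly K} := row_mx (map_mx polyC z) 'X%:M 0 j.
pose q := \sum_(mm <- mpoly.msupp P)
  mpoly.mcoeff mm P *: \prod_j v j ^+ mpoly.fun_of_multinom mm j.
have qE y : q.[y] = mpoly.meval (fun j => row_mx z y%:M 0 j) P.
  rewrite mpoly.mevalE horner_sum; apply: eq_bigr => mm _.
  rewrite hornerZ horner_prod; congr (_ * _); apply: eq_bigr => j _.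
  rewrite horner_exp /v; congr (_ ^+ _).
  case: (split_ordP j) => i ->; rewrite ?row_mxEl ?row_mxEr !mxE ?hornerC //.
  by rewrite !ord1 hornerMn hornerX.
rewrite -qE => qy0.
have q0 : q != 0 by apply: contraNneq qy0 => ->; rewrite horner0.
have [L LP] := polynomial_zeros q0; exists L => y.
by rewrite -qE => /eqP /LP.
Qed.

(** The values of [P k] at [x l] for [k, l <= N] form a triangular matrix with nonzero diagonal,
    hence an invertible one. It factors through the coefficient vectors of length [N], so its rank
    is at most [N]. *)
Lemma triangular_family_bound n d (P : nat -> mpoly.mpoly n F) (x : nat -> 'I_n -> F) :
  (forall k, (mpoly.mmeasure mpoly.mdeg (P k) <= d)%N) ->
  (forall k l, (l < k)%N -> mpoly.meval (x l) (P k) = 0) ->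
  ~ (forall k, mpoly.meval (x k) (P k) != 0).
Proof.
move=> Pd P0 Pn0; pose B : finType := mpoly.bmultinom n d; pose N := #|B|.
pose A : 'M[F]_(N.+1, N) :=
  \matrix_(k, b) mpoly.mcoeff (mpoly.bmnm (enum_val b : B)) (P k).
pose X : 'M[F]_(N, N.+1) :=
  \matrix_(b, l) \prod_i x l i ^+ mpoly.fun_of_multinom (mpoly.bmnm (enum_val b : B)) i.
have AX k l : (A *m X) k l = mpoly.meval (x l) (P k).
  rewrite mxE [in RHS](mpoly.mpolywE (Pd k)) raddf_sum /=.
  rewrite [RHS](reindex (enum_val : 'I_N -> B)) /=; last first.
    by exists enum_rank => b _; rewrite ?enum_valK ?enum_rankK.
  by apply: eq_bigr => b _; rewrite !mxE mpoly.mevalZ mpoly.mevalX.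
have AXu : A *m X \in unitmx.
  rewrite -unitmx_tr unitmxE det_trig ?unitfE.
    by apply/prodf_neq0 => i _; rewrite mxE AX.
  by apply/is_trig_mxP => i j ij; rewrite mxE AX P0.
have := mulmxV AXu; rewrite -mulmxA => /mulmx1_min.
by rewrite ltnn.
Qed.

End Mpoly.

(** * Values and polyradius of integer power series *)

Section Convergence.
Context {R : realType} {m : nat} (rho : 'rV[R]_m).
Hypothesis rho_itv : forall i, 0 < rho 0 i <= 1.
Local Notation C := R[i].
Local Notation I := {ffun 'I_m -> nat}.
Implicit Types (f g : int_powser m) (z : 'rV[C]_m) (k : I).

Definition coefs f : I -> C := fun k => (f k)%:~R.

Lemma powser_fun_conj f z : (polydisc 0 rho) z -> tame rho (coefs f) ->
  powser_fun f (cj z) = ((powser_fun f z)^*)%C.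
Proof.
move=> zD tf; rewrite !powser_funE -(ev_conj rho_itv zD tf).
by congr ev; apply/funext => k; rewrite conjc_int.
Qed.

Lemma powser_fun0 f : powser_fun f (0 : 'rV[C]_m) = (f [ffun=> 0%N])%:~R.
Proof.
rewrite powser_funE -[RHS](ev_constant _ (0 : 'rV[C]_m)) /ev.
congr (@summability.sum _ C C^o _); apply/funext => k.
rewrite /constant_series; case: eqP => [->//|k0].
have [i ki] : exists i, k i <> 0%N.
  by apply: contrapT => /forallNP e; apply: k0; apply/ffunP => i; rewrite ffunE; apply: contrapT.
rewrite /monomial (bigD1 i) //= mxE expr0n (introF eqP ki).
by rewrite mulr0n !mul0r mulr0.
Qed.

Lemma powser_funD f g z : (polydisc 0 rho) z -> tame rho (coefs f) ->
  tame rho (coefs g) ->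
  powser_fun (fun k => f k + g k) z = powser_fun f z + powser_fun g z.
Proof.
move=> zD tf tg; rewrite !powser_funE -(evD rho_itv zD tf tg).
by congr ev; apply/funext => k; rewrite intrD.
Qed.

Lemma weight0 : weight rho [ffun=> 0%N] = 1.
Proof. by rewrite /weight big1 // => i _; rewrite ffunE expr0 mulr1. Qed.

Lemma dominated_cvg f B z : dominated rho (coefs f) B -> (polydisc 0 rho) z ->
  powser_cvg f z.
Proof.
move=> fB zD; have [M zM] := dominated_sum rho_itv zD.
have fM := zM _ _ fB; rewrite /powser_cvg /esum.summable.
apply: (@le_lt_trans _ _ (B * M)%:E); last exact: ltry.
apply: ge_ereal_sup => _ [X [Xfin _] <-].
rewrite fsbig_finite //= sumEFin lee_fin.
apply: le_trans (fM (fset_set X)); apply: ler_sum => k _.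
by rewrite ger0_norm ?normc_ge0.
Qed.

(** If [rho 0 i] could be enlarged, the series would converge at the point whose only nonzero
    coordinate is [rho 0 i]; there the monomial of exponent [t] in that variable contributes at
    least [t + 1]. *)
Lemma polyradius_of_growth f B : dominated rho (coefs f) B ->
  (forall k, weight rho k <= normc (coefs f k)) -> has_polyradius f rho.
Proof.
move=> fB fge; split=> [z /(dominated_cvg fB)//|rho' rr' cvg'].
apply: contrapT => nrr'.
have [i ri] : exists i, rho 0 i < rho' 0 i.
  apply: contrapT => /forallNP e; apply: nrr'; apply/rowP => i.
  by apply/eqP; rewrite eq_le rr' andbT leNgt; apply/negP/e.
have r0 j : 0 < rho 0 j by case/andP: (rho_itv j).
pose z : 'rV[C]_m := \row_j if j == i then ((rho 0 i)%:C)%C else 0.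
have /cvg' zcvg : (polydisc 0 rho') z.
  apply/polydiscE => j; rewrite mxE; case: eqP => [->|_].
    by rewrite normc_real gtr0_norm.
  by rewrite normc0 (lt_le_trans (r0 j)).
have big t : (t.+1%:R%:E <= \esum_(k in [set: I])
    `|(normc (powser_term f z k))%:E|)%E.
  pose k : I := [ffun j => if j == i then t else 0%N].
  apply: esum_ge; exists [set k]; first by split => //; apply: finite_set1.
  rewrite fsbig_set1 /= lee_fin ger0_norm ?normc_ge0 // normcM.
  apply: le_trans (ler_wpM2r (normc_ge0 _) (fge k)).
  rewrite (weight_monomial rho z k) (bigD1 i) //= big1 => [|j ji]; last first.
    by rewrite ffunE (negbTE ji) expr0 mulr1.
  rewrite !mxE ffunE eqxx normc_real gtr0_norm // divff ?gt_eqF //.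
  by rewrite expr1n !mulr1.
move: zcvg big; rewrite /powser_cvg /esum.summable.
case: (\esum_(k in _) _)%E => [r _ big|//|_ /(_ 0%N)//].
have := big (Num.truncn r); rewrite lee_fin leNgt.
by rewrite truncnS_gt.
Qed.

End Convergence.

(** * The sequence of corrections *)

Section Construction.
Context {R : realType} {m : nat} (rho : 'rV[R]_m).
Hypothesis rho_itv : forall i, 0 < rho 0 i <= 1.
Local Notation C := R[i].
Local Notation I := {ffun 'I_m -> nat}.
Implicit Types (z : 'rV[C]_m) (k : I) (P : mpoly.mpoly (m + 1) C).
Variables (S : set 'rV[C]_m) (a : nat -> 'rV[C]_m) (avoid : nat -> int_powser m).
Hypothesis aD : forall n, (polydisc 0 rho) (a n).

(** At such indices the value is still free. The value at the conjugate of a point follows from the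
    real coefficients, and the value at 0 is the constant coefficient. *)
Definition fresh n := a n != 0 /\ forall j, (j < n)%N -> a j <> a n /\ cj (a j) <> a n.

Definition vanishing n d (f : int_powser m) P :=
  [/\ (mpoly.mmeasure mpoly.mdeg P <= d)%N,
    forall j, (j < n)%N -> mpoly.meval (pt (a j) (powser_fun f (a j))) P = 0 &
    exists y, mpoly.meval (pt (a n) y) P != 0].

(** Bounding [j] and [d] by [n] makes the last two conditions exclude only finitely many values at
    [a n], while every [j] and [d] is taken care of from some index on. *)
Definition stage n (f f' : int_powser m) :=
  [/\ dominated rho (coefs (fun k => f' k - f k)) (2 ^- n.+1),
    forall j, (j < n)%N -> powser_fun f' (a j) = powser_fun f (a j) &
    fresh n ->
    [/\ algebraic_number (powser_fun f' (a n)) <-> S (a n),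
      forall j, (j <= n)%N -> powser_fun f' (a n) <> powser_fun (avoid j) (a n) &
      forall d, (d <= n)%N -> (exists P, vanishing n d f P) ->
        exists2 P, vanishing n d f P &
          mpoly.meval (pt (a n) (powser_fun f' (a n))) P != 0]].

Lemma exceptional_values n f : exists L : seq C, forall y, y \notin L ->
  forall d, (d <= n)%N -> (exists P, vanishing n d f P) ->
    exists2 P, vanishing n d f P & mpoly.meval (pt (a n) y) P != 0.
Proof.
suff [L LP] : exists L : seq C, forall y, y \notin L ->
    forall d, (d < n.+1)%N -> (exists P, vanishing n d f P) ->
    exists2 P, vanishing n d f P & mpoly.meval (pt (a n) y) P != 0.
  by exists L.
(* The bound on [d] runs by induction while the index [n] of the point stays fixed; each new [d]
   adds at most the zeros of one polynomial to [L]. *)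
elim: n.+1 => [|N [L LP]]; first by exists [::].
have [[P PN]|noP] := pselect (exists P, vanishing n N f P).
  have [_ _ [y0 Py0]] := PN; have [L' L'P] := mpoly_last_zeros Py0.
  exists (L ++ L') => y; rewrite mem_cat negb_or => /andP[yL yL'] d.
  rewrite ltnS leq_eqVlt => /predU1P[->|dN] exP; last exact: LP.
  by exists P => //; apply: contra yL' => /eqP /L'P.
exists L => y yL d; rewrite ltnS leq_eqVlt => /predU1P[->|dN] exP; last exact: LP.
by case: noP.
Qed.

Lemma half_pow_gt0 n : 0 < 2 ^- n :> R.
Proof. by rewrite invr_gt0 exprn_gt0. Qed.

Lemma stage_exists n f : tame rho (coefs f) -> exists f', stage n f f'.
Proof.
move=> tf; have [[an0 an]|nf] := pselect (fresh n); last first.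
  exists f; split => // k; rewrite /coefs subrr normc0.
  by rewrite mulr_ge0 ?(weight_ge0 rho_itv) // ltW // half_pow_gt0.
(* The origin is left out, since a polynomial with constant term 1 cannot vanish there. Integrality
   preserves the value at 0 instead. *)
pose pts := [seq a j | j <- iota 0 n & a j != 0].
have [|delta delta0 stepP] := @step R m rho rho_itv pts (a n) _ (half_pow_gt0 n.+1) (aD n) an0.
  move=> p /mapP[j]; rewrite mem_filter mem_iota /= add0n => /andP[aj0 jn] ->.
  by have [? ?] := an j jn; split.
have [L LP] := exceptional_values n f.
pose L' := L ++ [seq powser_fun (avoid j) (a n) | j <- iota 0 n.+1].
pose x := powser_fun f (a n).
have [w [wd wreal wS wL]] : exists w, [/\ normc w <= delta, x^*%C = x -> w^*%C = w,
    algebraic_number (x + w) <-> S (a n) & x + w \notin L'].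
  have [Sn|Sn] := pselect (S (a n)).
    have [w [wd wr wa wL]] := algebraic_near x L' delta0.
    by exists w; split.
  have [w [wd wr wa wL]] := transcendental_near x L' delta0.
  by exists w; split.
have [|g [gB g0 gw]] := stepP w wd.
  (* At a real point [x] is real, because the coefficients of [f] are, so [w] is real too. *)
  by move=> aa; apply: wreal; rewrite /x -(powser_fun_conj rho_itv (aD n) tf) aa.
have tg : tame rho (coefs g) by exists (2 ^- n.+1).
have evD z : (polydisc 0 rho) z ->
    powser_fun (fun k => f k + g k) z = powser_fun f z + powser_fun g z.
  by move=> zD; apply: (powser_funD rho_itv).
exists (fun k => f k + g k); split.
- by move=> k; rewrite /coefs addrC addKr; apply: gB.
- move=> j jn; rewrite evD //; have [aj0|aj0] := eqVneq (a j) 0; last first.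
    rewrite g0 ?addr0 //; apply/mapP; exists j => //.
    by rewrite mem_filter aj0 mem_iota.
  (* The constant coefficient of [g] is an integer of absolute value at most [2 ^- n.+1 < 1], since
     the weight of the zero exponent is 1; hence it is 0. *)
  rewrite aj0 [X in _ + X]powser_fun0; have := gB [ffun=> 0%N].
  rewrite weight0 mulr1 normc_int => g1.
  have {}g1 : `|(g [ffun=> 0%N])%:~R : R| < 1.
    apply: le_lt_trans g1 _; rewrite invf_lt1 ?exprn_egt1 ?exprn_gt0 //.
    by rewrite ltr1n.
  rewrite (_ : g _ = 0) ?addr0 //; move: g1.
  by rewrite -intr_norm -[X in _ < X]/(1%:~R) ltr_int; lia.
- rewrite evD // gw -/x => _; move: wL; rewrite mem_cat negb_or => /andP[wL wL'].
  split => // [j jn xj|]; last exact: LP.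
  by case/mapP: wL'; exists j => //; rewrite mem_iota.
Qed.

Lemma stages_exist f0 : tame rho (coefs f0) -> exists F : nat -> int_powser m,
  [/\ F 0%N = f0, forall n, tame rho (coefs (F n)) & forall n, stage n (F n) (F n.+1)].
Proof.
move=> t0.
have /choice[next nextP] : forall nf : nat * int_powser m, exists f',
    tame rho (coefs nf.2) -> stage nf.1 nf.2 f'.
  move=> [n f] /=; have [tf|ntf] := pselect (tame rho (coefs f)); last by exists f.
  by have [f' ?] := stage_exists n tf; exists f'.
pose F := fix F n := if n is n'.+1 then next (n', F n') else f0.
have tF n : tame rho (coefs (F n)).
  elim: n => [//|n tFn] /=.
  have [d _ _] := nextP (n, F n) tFn.
  have -> : coefs (next (n, F n)) =
      fun k => coefs (F n) k + coefs (fun k => next (n, F n) k - F n k) k :> C.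
    by apply/funext => k; rewrite /coefs intrB addrC subrK.
  by apply: tameD => //; exists (2 ^- n.+1).
by exists F; split => // n; apply: (nextP (n, F n)) (tF n).
Qed.

(** * The limit series and its values *)

Section Limit.
Variable F : nat -> int_powser m.
Hypothesis F_tame : forall n, tame rho (coefs (F n)).
Hypothesis F_stage : forall n, stage n (F n) (F n.+1).

(** Each coefficient runs through an integer sequence that becomes constant; this index is late
    enough, so no limit has to be taken. *)
Definition limit : int_powser m := fun k => F (Num.truncn (weight rho k)) k.

(** The bounds [2 ^- j.+1] for [n <= j < n + p] add up to the difference shown. *)
Lemma stage_telescope n p k :
  `|(F (n + p)%N k)%:~R - (F n k)%:~R : R| <= (2 ^- n - 2 ^- (n + p)) * weight rho k.
Proof.
elim: p => [|p IHp]; first by rewrite addn0 !subrr normr0 mul0r.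
have [/(_ k) + _ _] := F_stage (n + p).
rewrite /coefs normc_int addnS exprS invfM intrB => d.
set u := (F _.+1 k)%:~R in d *; set v := (F (n + p)%N k)%:~R in d IHp *.
rewrite (_ : u - _ = (u - v) + (v - (F n k)%:~R)); last by ring.
apply: le_trans (ler_normD _ _) _; apply: le_trans (lerD d IHp) _.
by rewrite le_eqVlt; apply/orP; left; apply/eqP; move: (2 ^- (n + p)) (2 ^- n) => x y; field.
Qed.

(** From this index on, a correction is an integer smaller than 1 in absolute value: the weight is
    below [N + 1], hence below [2 ^ (N + 1)]. *)
Lemma limit_stable n k : (Num.truncn (weight rho k) <= n)%N -> F n k = limit k.
Proof.
move=> /subnKC <-; elim: (n - _)%N => [|p IHp]; first by rewrite addn0.
rewrite -{}IHp addnS; set N := (_ + p)%N.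
have [/(_ k) + _ _] := F_stage N; rewrite /coefs normc_int => d.
have : `|(F N.+1 k - F N k)%:~R : R| < 1.
  apply: le_lt_trans d _; rewrite mulrC ltr_pdivrMr ?exprn_gt0 // mul1r.
  apply: lt_le_trans (truncnS_gt _) _; rewrite -natrX ler_nat.
  apply: leq_trans (_ : N.+1 <= _)%N; last exact: ltnW (ltn_expl _ _).
  exact: leq_addr.
rewrite -intr_norm -[X in _ < X]/(1%:~R) ltr_int; lia.
Qed.

Lemma limit_close n : dominated rho (coefs (fun k => limit k - F n k)) (2 ^- n).
Proof.
move=> k; rewrite /coefs normc_int intrB.
rewrite -(@limit_stable (n + Num.truncn (weight rho k)) k) ?leq_addl //.
apply: le_trans (stage_telescope _ _ _) _.
by rewrite ler_wpM2r ?(weight_ge0 rho_itv) // gerBl ltW // half_pow_gt0.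
Qed.

Lemma limit_tame : tame rho (coefs limit).
Proof.
have -> : coefs limit =
    fun k => coefs (F 0%N) k + coefs (fun k => limit k - F 0%N k) k :> C.
  by apply/funext => k; rewrite /coefs intrB addrC subrK.
by apply: tameD => //; exists (2 ^- 0); apply: limit_close.
Qed.

(** From index [j + 1] on, the value at [a j] no longer changes, and it passes to the limit because
    evaluation is bounded relative to the weight. *)
Lemma limit_value n j : (j < n)%N -> powser_fun limit (a j) = powser_fun (F n) (a j).
Proof.
move=> jn.
have Fconst p : powser_fun (F (n + p)%N) (a j) = powser_fun (F n) (a j).
  elim: p => [|p IHp]; first by rewrite addn0.
  have [_ FE _] := F_stage (n + p).
  by rewrite addnS -IHp FE // (leq_trans jn) // leq_addr.
have [M zM] := ev_norm_le rho_itv (aD j).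
apply/eqP; rewrite -subr_eq0; apply/eqP/normc_small => e e0.
pose p := Num.truncn (`|M| / e).
have pe : 2 ^- (n + p) * M < e.
  apply: le_lt_trans (ler_wpM2l (ltW (half_pow_gt0 _)) (ler_norm M)) _.
  rewrite mulrC ltr_pdivrMr ?exprn_gt0 // mulrC -ltr_pdivrMr //.
  apply: lt_le_trans (truncnS_gt _) _; rewrite -natrX ler_nat -/p.
  apply: (@leq_trans (2 ^ p)); first exact: ltn_expl.
  by rewrite leq_exp2l // leq_addl.
apply: le_lt_trans pe; apply: le_trans (zM _ _ (@limit_close (n + p))).
have tL : tame rho (coefs (fun k => limit k - F (n + p)%N k)).
  by exists (2 ^- (n + p)); apply: limit_close.
have limitE : limit = fun k => (limit k - F (n + p)%N k) + F (n + p)%N k.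
  by apply/funext => k; rewrite subrK.
rewrite [in X in X <= _]limitE (powser_funD rho_itv (aD j) tL (F_tame (n + p))).
by rewrite -(Fconst p) addrK.
Qed.

End Limit.

End Construction.

(** * Transcendence, exceptional set and polyradius of the limit *)

Section Conclusion.
Context {R : realType} {m : nat} (rho : 'rV[R]_m).
Hypothesis m_gt0 : (0 < m)%N.
Hypothesis rho_itv : forall i, 0 < rho 0 i <= 1.
Local Notation C := R[i].
Local Notation I := {ffun 'I_m -> nat}.
Implicit Types (z : 'rV[C]_m) (k : I) (P : mpoly.mpoly (m + 1) C).
Variables (S : set 'rV[C]_m) (a : nat -> 'rV[C]_m) (avoid : nat -> int_powser m).
Hypothesis S_sub : S `<=` algebraic_points (polydisc 0 rho).
Hypothesis S_conj : conj_closed S.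
Hypothesis S_0 : S 0.
Hypothesis a_alg : forall n, algebraic_points (polydisc 0 rho) (a n).
Hypothesis a_surj : forall z, algebraic_points (polydisc 0 rho) z -> exists n, a n = z.

Let aD n : (polydisc 0 rho) (a n).
Proof. by case: (a_alg n). Qed.

(** The point sought has rational coordinates, hence is algebraic and its own conjugate. Infinitely
    many values remain for each coordinate after excluding those of the first [n0] points, so a
    nonzero polynomial cannot vanish at all such points. *)
Lemma fresh_after n0 P : P != 0 -> exists n, [/\ (n0 <= n)%N, fresh a n &
  exists y, mpoly.meval (pt (a n) y) P != 0].
Proof.
move=> P0; pose i0 := Ordinal m_gt0.
pose Q (j : 'I_(m + 1)) : set C := match fintype.split j with
  | inl i => [set x | exists2 q : rat, x = ratr q &
      0 < (ratr q : R) < rho 0 i /\ x \notin [seq a j 0 i | j <- iota 0 n0]]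
  | inr _ => setT end.
have [|v vQ vP] := mpoly_nonvanishing (Q := Q) P0.
  move=> j L; rewrite /Q; case: (fintype.split j) => [i|_].
    have r0 : 0 < rho 0 i by case/andP: (rho_itv i).
    have [q [qr qL]] := rat_in_itv_avoiding (L ++ [seq a j 0 i | j <- iota 0 n0]) r0.
    move: qL; rewrite mem_cat negb_or => /andP[qL qa].
    by exists (ratr q) => //; exists q.
  by have [q [_ qL]] := rat_in_itv_avoiding L (@ltr01 R); exists (ratr q).
have vQi i : exists2 q : rat, v (lshift 1 i) = ratr q &
    0 < (ratr q : R) < rho 0 i /\ v (lshift 1 i) \notin [seq a j 0 i | j <- iota 0 n0].
  by have := vQ (lshift 1 i); rewrite /Q (unsplitK (inl i)).
pose z : 'rV[C]_m := \row_i v (lshift 1 i).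
have zr : cj z = z.
  by apply/rowP => i; rewrite !mxE; have [q -> _] := vQi i; rewrite ratrC conjc_real.
have [N /eqP aN] : exists N, a N = z.
  apply: a_surj; split => [|i]; last first.
    by rewrite mxE; have [q -> _] := vQi i; apply: algebraic_rat.
  apply/polydiscE => i; rewrite mxE; have [q -> [/andP[q0 qr] _]] := vQi i.
  by rewrite ratrC normc_real gtr0_norm.
(* The least index of [z] is fresh: [z] being real, an earlier conjugate would be an earlier
   occurrence of [z]. *)
have [n /eqP an nmin] := ex_minnP (ex_intro (fun N => a N == z) N aN).
exists n; split.
- rewrite leqNgt; apply/negP => nn0; have [q _ [_ /negP]] := vQi i0; apply.
  by apply/mapP; exists n; rewrite ?mem_iota // an mxE.
- rewrite /fresh an; split.
    apply/eqP => /rowP /(_ i0); rewrite !mxE; have [q -> [/andP[q0 _] _]] := vQi i0.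
    by rewrite ratrC => /complexI q00; rewrite q00 ltxx in q0.
  move=> j jn; split=> [/eqP|] ajz.
    by have := nmin j ajz; rewrite leqNgt jn.
  suff /nmin : a j == z by rewrite leqNgt jn.
  by apply/eqP; rewrite -zr -ajz cjK.
- exists (v (rshift m ord0)); rewrite an.
  rewrite (_ : (fun j => _) = v) //; apply/funext => j.
  case: (split_ordP j) => i ->; rewrite ?row_mxEl ?row_mxEr !mxE //.
  by rewrite !ord1 eqxx mulr1n.
Qed.

Variable F : nat -> int_powser m.
Hypothesis F_tame : forall n, tame rho (coefs (F n)).
Hypothesis F_stage : forall n, stage rho S a avoid n (F n) (F n.+1).
Let f := limit rho F.

Lemma limit_at n j : (j < n)%N -> powser_fun f (a j) = powser_fun (F n) (a j).
Proof. exact: (limit_value rho_itv aD F_tame F_stage). Qed.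

Lemma limit_avoids j : f <> avoid j.
Proof.
(* The constant polynomial 1 serves here, as any fresh index from [j] on will do. *)
move=> fj; have [n [jn fn _]] := fresh_after j (oner_neq0 _).
have [_ _ /(_ fn)[_ /(_ j jn) + _]] := F_stage n.
by rewrite -limit_at // -fj.
Qed.

Lemma limit_transcendental : transcendental (polydisc 0 rho) (powser_fun f).
Proof.
move=> P PF; apply: contrapT => /eqP P0; pose d := mpoly.mmeasure mpoly.mdeg P.
(* At a fresh index [n >= d] the relation [P] itself is a candidate, so the stage has taken care of
   some polynomial of size at most [d] that vanishes at the earlier points of the graph and not at
   the one over [a n]. *)
have /choice[nx nxP] : forall n0, exists nQ : nat * mpoly.mpoly (m + 1) C,
    [/\ (n0 <= nQ.1)%N, (mpoly.mmeasure mpoly.mdeg nQ.2 <= d)%N,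
      forall j, (j < nQ.1)%N -> mpoly.meval (pt (a j) (powser_fun f (a j))) nQ.2 = 0 &
      mpoly.meval (pt (a nQ.1) (powser_fun f (a nQ.1))) nQ.2 != 0].
  move=> n0; have [n [nn fn Pn]] := fresh_after (maxn n0 d) P0.
  move: nn; rewrite geq_max => /andP[n0n dn].
  have [_ _ /(_ fn)[_ _ /(_ d dn)]] := F_stage n.
  case=> [|Q [Qd Qj _] Qn].
    exists P; split => // j jn; rewrite -(limit_at jn); apply: PF; exact: aD.
  exists (n, Q); split; [exact: n0n|exact: Qd|move=> j jn|].
    by rewrite (limit_at jn); apply: Qj.
  by rewrite (limit_at (ltnSn n)).
(* Each index is chosen beyond the previous one, which makes the family triangular. *)
pose s := fix s (k : nat) := if k is k'.+1 then nx (s k').1.+1 else nx 0%N.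
have sP (k : nat) : exists n0, s k = nx n0 by case: k => [|k]; eexists.
have s_lt (k l : nat) : (l < k)%N -> ((s l).1 < (s k).1)%N.
  elim: k => [//|k IHk]; rewrite ltnS leq_eqVlt.
  have step : ((s k).1 < (s k.+1).1)%N by have [] := nxP (s k).1.+1.
  by case/predU1P => [->//|/IHk lk]; apply: ltn_trans step.
pose x (k : nat) := pt (a (s k).1) (powser_fun f (a (s k).1)).
apply: (@triangular_family_bound _ _ d (fun k : nat => (s k).2) x) => /=.
- by move=> k; have [n0 ->] := sP k; have [_ Pd _ _] := nxP n0.
- move=> k l /s_lt; rewrite /x; have [n0 ->] := sP k.
  by have [_ _ + _] := nxP n0; apply.
- by move=> k; rewrite /x; have [n0 ->] := sP k; have [_ _ _ Pn0] := nxP n0.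
Qed.

Lemma exceptional_iff z : algebraic_points (polydisc 0 rho) z ->
  algebraic_number (powser_fun f z) <-> S z.
Proof.
move=> zA; have [->|z0] := eqVneq z 0.
  by rewrite powser_fun0; split => // _; apply: algebraic_int.
have [zD _] := zA; have [N /eqP aN] := a_surj zA.
(* The first index of [z] or of its conjugate is fresh, so the value there was prescribed;
   conjugation carries the equivalence over to [z]. *)
have aN' : (a N == z) || (a N == cj z) by rewrite aN.
have [n anz nmin] := ex_minnP (ex_intro (fun N => (a N == z) || (a N == cj z)) N aN').
have fn : fresh a n.
  split=> [|j jn].
    case/orP: anz => /eqP -> //; apply: contra_neq z0 => /(congr1 (map_mx (@conjc R))).
    by rewrite cjK => ->; apply/rowP => i; rewrite !mxE conjc0.
  split=> aj; suff /nmin : (a j == z) || (a j == cj z) by rewrite leqNgt jn.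
    by rewrite aj.
  by case/orP: anz => /eqP anz; rewrite -[a j]cjK aj anz ?cjK eqxx ?orbT.
have [_ _ /(_ fn)[+ _ _]] := F_stage n.
rewrite -limit_at //; case/orP: anz => /eqP -> //.
rewrite (powser_fun_conj rho_itv) //; last exact: (limit_tame rho_itv F_tame F_stage).
move=> H; rewrite -algebraic_conjE H; split=> [/S_conj|/S_conj//].
by rewrite cjK.
Qed.

Lemma limit_exceptional : exceptional_set (polydisc 0 rho) (powser_fun f) = S.
Proof.
apply/seteqP; split=> z; first by case=> /exceptional_iff zS /zS.
by move=> Sz; split; [apply: S_sub|apply/exceptional_iff => //; apply: S_sub].
Qed.

Lemma limit_polyradius : (forall k, F 0%N k = Num.ceil (2 * weight rho k)) ->
  has_polyradius f rho.
Proof.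
move=> F0.
have W0 := weight_ge0 rho_itv; have W1 := weight_ge1 rho_itv.
have D k : 2 * weight rho k <= (F 0%N k)%:~R < 2 * weight rho k + 1.
  by rewrite F0; have := ceil_itv (2 * weight rho k); rewrite intrB; lra.
have close k : `|(f k)%:~R - (F 0%N k)%:~R : R| <= weight rho k.
  have := limit_close rho_itv F_stage 0 k.
  by rewrite /coefs normc_int intrB expr0 invr1 mul1r.
(* With [W] the weight, [W >= 1] absorbs the rounding error: [2 W <= F 0 < 3 W], and the limit
   differs from [F 0] by at most [W]. *)
apply: (@polyradius_of_growth _ _ _ rho_itv f 4) => k; rewrite /coefs normc_int.
  have := close k; have := D k; have := W1 k; rewrite !ler_norml; lra.
apply: le_trans (ler_norm _); have := close k; have := D k; rewrite ler_norml; lra.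
Qed.

End Conclusion.

(** * Uncountability of the set of solutions *)

(** The default [x0] fills the indices that enumerate nothing, and covers an empty [A]. *)
Lemma countable_enum (T : Type) (A : set T) (x0 : T) : countable A ->
  exists e : nat -> T, (forall n, A (e n) \/ e n = x0) /\ forall x, A x -> exists n, e n = x.
Proof.
move=> /countable_injP[g g_inj].
have /choice[e eP] : forall n, exists x,
    (A x \/ x = x0) /\ forall y, A y -> g y = n -> x = y.
  move=> n; have [[x [Ax gx]]|no] := pselect (exists x, A x /\ g x = n).
    exists x; split=> [|y Ay gy]; first by left.
    by apply: g_inj; rewrite ?inE // gx gy.
  by exists x0; split=> [|y Ay gy]; [right|case: no; exists y].
exists e; split=> [n|x Ax]; first by case: (eP n).
by exists (g x); have [_ egx] := eP (g x); apply: egx.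
Qed.

Theorem mainTheorem1 (R : realType) (m : nat) (m_gt0 : (0 < m)%N)
    (rho : 'rV[R]_m) (rho_itv : forall i, 0 < rho 0 i <= 1)
    (S : set 'rV[R[i]]_m)
    (S_sub : S `<=` algebraic_points (polydisc 0 rho))
    (S_conj : conj_closed S) (S_0 : S 0) :
  ~ countable [set f : int_powser m |
      [/\ has_polyradius f rho,
          transcendental (polydisc 0 rho) (powser_fun f) &
          exceptional_set (polydisc 0 rho) (powser_fun f) = S]].
Proof.
(* Diagonal argument: from an enumeration of all solutions, the construction yields one that is not
   listed. The default series 0 may be listed without harm. *)
move=> /(countable_enum (fun=> 0))[avoid [_ avoidP]].
have [a [aA a_surj]] : exists a : nat -> 'rV[R[i]]_m,
    (forall n, algebraic_points (polydisc 0 rho) (a n)) /\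
    forall z, algebraic_points (polydisc 0 rho) z -> exists n, a n = z.
  have [|a [aA a_surj]] := @countable_enum _ (algebraic_points (polydisc 0 rho))
    (0 : 'rV[R[i]]_m).
    apply: sub_countable (countable_rV m (@algebraic_numbers_countable R)).
    by apply: subset_card_le => z [].
  by exists a; split => // n; case: (aA n) => [//|->]; apply: S_sub.
have aD n : (polydisc 0 rho) (a n) by case: (aA n).
pose f0 : int_powser m := fun k => Num.ceil (2 * weight rho k).
have t0 : tame rho (coefs f0).
  exists 3 => k; rewrite /coefs normc_int /f0.
  have := weight_ge1 rho_itv k; have := ceil_itv (2 * weight rho k).
  by rewrite ler_norml intrB; lra.
have [F [F0 F_tame F_stage]] := stages_exist rho_itv S avoid aD t0.
have [|n] := avoidP (limit rho F).
  split.
  - by apply: (limit_polyradius rho_itv F_stage) => k; rewrite F0.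
  - exact: (limit_transcendental m_gt0 rho_itv aA a_surj F_tame F_stage).
  - exact: (limit_exceptional rho_itv S_sub S_conj S_0 aA a_surj F_tame F_stage).
by move/esym; apply: (limit_avoids m_gt0 rho_itv aA a_surj F_tame F_stage).
Qed.
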